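(* We have $E^H_{\mathrm{Lip}([0,1])} \sim_B \ell_\infty$ and $E^S_{\mathrm{Lip}([0,1])} \sim_B \ell_\infty$.
   Context: $\mathcal{H}^+([0,1])$ is the Polish group of increasing homeomorphisms of $[0,1]$ onto itself, with the supremum metric. $\mathrm{Lip}([0,1]) = \{f \in \mathcal{H}^+([0,1]) : f \text{ and } f^{-1} \text{ are Lipschitz}\}$, a subgroup of $\mathcal{H}^+([0,1])$. $\mathcal{F}([0,1])$ is the space of closed (equivalently compact) subsets of $[0,1]$ with the Vietoris topology. $E^H_{\mathrm{Lip}([0,1])}$ is the equivalence relation on $\mathcal{F}([0,1])$ given by: $F_1 \, E^H_{\mathrm{Lip}([0,1])} \, F_2$ iff there is $g \in \mathrm{Lip}([0,1])$ with $g(F_1) = F_2$. $E^S_{\mathrm{Lip}([0,1])}$ is the equivalence relation on $\mathcal{H}^+([0,1])$ given by: $h_1 \, E^S_{\mathrm{Lip}([0,1])}\, h_2$ iff there is $g \in \mathrm{Lip}([0,1])$ with $g \circ h_1 = h_2$ (iff $h_2 \circ h_1^{-1} \in \mathrm{Lip}([0,1])$). $\ell_\infty$ denotes the equivalence relation on $\mathbb{R}^{\mathbb{N}}$ given by $(x_n)\,\ell_\infty\,(y_n)$ iff $\sup_n |x_n - y_n| < \infty$. For equivalence relations $E, F$ on standard Borel spaces $X, Y$: $E \leq_B F$ means there is a Borel map $f: X \to Y$ with $x E y \iff f(x) F f(y)$ for all $x,y\in X$; $E \sim_B F$ means $E \leq_B F$ and $F \leq_B E$. *)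

(* Defs.v *)
From HB Require Import structures.
From mathcomp Require Import all_boot all_order all_algebra.
From mathcomp Require Import all_classical all_reals all_analysis.
From mathcomp Require Import lra.

Set Implicit Arguments.
Unset Strict Implicit.
Unset Printing Implicit Defensive.

Import Order.TTheory GRing.Theory Num.Theory.
Import numFieldNormedType.Exports.

Local Open Scope classical_set_scope.
Local Open Scope ring_scope.

HB.instance Definition _ (U : Type) (T : U -> ptopologicalType) :=
  Pointed.copy (prod_topology T) (forall x : U, T x).

(* The base point in [ptopologicalType] is only there because the library's
   [measurableType]s are pointed. *)
Definition borel_space (T : ptopologicalType) :=
  g_sigma_algebraType (@open T).

Definition borel_reducible (X Y : ptopologicalType)
    (E : X -> X -> Prop) (F : Y -> Y -> Prop) : Prop :=
  exists f : X -> Y,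
    measurable_fun setT (f : borel_space X -> borel_space Y) /\
    forall x y : X, E x y <-> F (f x) (f y).

Definition borel_bireducible (X Y : ptopologicalType)
    (E : X -> X -> Prop) (F : Y -> Y -> Prop) : Prop :=
  borel_reducible E F /\ borel_reducible F E.

(* The empty set is admitted as a closed set; it is an isolated point of the
   Vietoris topology below. *)
Record closed_subset (T : topologicalType) := ClosedSubset {
  closed_subset_set :> set T;
  closed_subset_closed : closed closed_subset_set }.

Section vietoris.
Variable T : topologicalType.

HB.instance Definition _ := gen_eqMixin (closed_subset T).
HB.instance Definition _ := gen_choiceMixin (closed_subset T).
HB.instance Definition _ :=
  isPointed.Build (closed_subset T) (ClosedSubset (@closed0 T)).

Definition vietoris_subbase : set (set (closed_subset T)) :=
  [set [set F : closed_subset T | F `<=` U] | U in @open T] `|`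
  [set [set F : closed_subset T | F `&` U !=set0] | U in @open T].

HB.instance Definition _ :=
  isSubBaseTopological.Build (closed_subset T) vietoris_subbase id.

End vietoris.

Notation unit_interval R := (set_type (`[0, 1]%classic : set R)).

Section lipschitz_relations.
Variable R : realType.

Local Notation I := (unit_interval R).

Record incr_homeo := IncrHomeo {
  homeo_fun :> I -> I;
  homeo_inv : I -> I;
  homeo_funK : cancel homeo_fun homeo_inv;
  homeo_invK : cancel homeo_inv homeo_fun;
  homeo_fun_continuous : continuous homeo_fun;
  homeo_inv_continuous : continuous homeo_inv;
  homeo_fun_incr : {homo homeo_fun : x y / set_val x < set_val y} }.

Lemma incr_homeo_eq (f g : incr_homeo) : f =1 g -> f = g.
Proof.
case: f g => [f f' fK f'K fc f'c fi] [g g' gK g'K gc g'c gi] /= /funext fg.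
subst g; have e : f' = g'.
  by apply/funext => x; rewrite -[in LHS](g'K x) fK.
by subst g'; congr IncrHomeo; exact: Prop_irrelevance.
Qed.

HB.instance Definition _ := gen_eqMixin incr_homeo.
HB.instance Definition _ := gen_choiceMixin incr_homeo.

Let id_continuous : continuous (@id I).
Proof. by move=> x; exact: cvg_id. Qed.

Definition incr_homeo_id : incr_homeo :=
  @IncrHomeo id id (fun=> erefl) (fun=> erefl)
    id_continuous id_continuous (fun _ _ => id).

HB.instance Definition _ := isPointed.Build incr_homeo incr_homeo_id.

Definition sup_dist (f g : incr_homeo) : R :=
  sup (range (fun x : I => `|set_val (f x) - set_val (g x)|)).

Let i0 : I.
Proof. by exists 0; rewrite inE/= in_itv/= lexx ler01. Defined.

Let set_val01 (x : I) : 0 <= set_val x <= 1.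
Proof. by case: x => x; rewrite set_valE/= inE/= in_itv. Qed.

Let has_sup_dist (f g : incr_homeo) :
  has_sup (range (fun x : I => `|set_val (f x) - set_val (g x)|)).
Proof.
split; first by exists `|set_val (f i0) - set_val (g i0)|; exists i0.
exists 1 => _ [x _ <-]; rewrite ler_norml.
by have /andP[? ?] := set_val01 (f x); have /andP[? ?] := set_val01 (g x); lra.
Qed.

Let sup_dist_ub (f g : incr_homeo) x :
  `|set_val (f x) - set_val (g x)| <= sup_dist f g.
Proof. by apply: sup_ubound; [exact: (has_sup_dist f g).2 | exists x]. Qed.

Let sup_dist_le (f g : incr_homeo) M :
  (forall x, `|set_val (f x) - set_val (g x)| <= M) -> sup_dist f g <= M.
Proof.
move=> h; apply: ge_sup; first exact: (has_sup_dist f g).1.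
by move=> _ [x _ <-].
Qed.

Let sup_distxx f : sup_dist f f = 0.
Proof.
apply/eqP; rewrite eq_le; apply/andP; split.
  by apply: sup_dist_le => x; rewrite subrr normr0.
exact: le_trans (normr_ge0 _) (sup_dist_ub f f i0).
Qed.

Let sup_dist_positivity f g : sup_dist f g = 0 -> f = g.
Proof.
move=> fg0; apply: incr_homeo_eq => x; apply: val_inj.
have := sup_dist_ub f g x; rewrite fg0 normr_le0 subr_eq0 => /eqP.
by rewrite set_valE.
Qed.

Let sup_dist_sym f g : sup_dist f g = sup_dist g f.
Proof. by congr sup; apply: eq_imagel => x _; rewrite distrC. Qed.

Let sup_dist_triangle g f h : sup_dist f h <= sup_dist f g + sup_dist g h.
Proof.
apply: sup_dist_le => x.
by rewrite (le_trans (ler_distD (set_val (g x)) _ _))// lerD.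
Qed.

HB.instance Definition _ := @isMetric.Build R incr_homeo sup_dist
  sup_distxx sup_dist_positivity sup_dist_sym sup_dist_triangle.

Definition lipschitz_unit (f : I -> I) : Prop :=
  exists k : R, forall x y : I,
    `|set_val (f x) - set_val (f y)| <= k * `|set_val x - set_val y|.

Definition Lip : set incr_homeo :=
  [set f : incr_homeo | lipschitz_unit f /\ lipschitz_unit (homeo_inv f)].

Definition EH_Lip (F1 F2 : closed_subset I) : Prop :=
  exists2 g : incr_homeo, Lip g & g @` F1 = F2.

Definition ES_Lip (h1 h2 : incr_homeo) : Prop :=
  exists2 g : incr_homeo, Lip g & g \o h1 = h2.

(* [{ptws nat -> R}] carries the product topology. *)
Definition ell_infty (x y : {ptws nat -> R}) : Prop :=
  (ereal_sup (range (fun n : nat => `|x n - y n|%:E)) < +oo)%E.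

End lipschitz_relations.

(* Main.v *)
(* Both relations ask for increments to be comparable up to a constant.

   For E^S this is immediate: h1 and h2 are equivalent iff the logarithms of
   |h1 p - h1 q| and |h2 p - h2 q|, for p and q in a countable dense set, stay
   at bounded distance.

   For E^H, let L_k be the set of 2^k-bi-Lipschitz homeomorphisms and let
   d(F, A) be the least k such that g(F) belongs to A for some g in L_k. As
   L_j L_k is contained in L_(j+k), the functions min(m, d(-, A)) are 1-Lipschitz
   along the orbits, and they are Borel when A is open, since {d(-, A) <= k} is
   a union of translates of A. If they stay at bounded distance on F1 and F2
   for all m and all A in a countable base, then some L_m moves F1
   arbitrarily close to F2, hence onto F2 by compactness of L_m.

   Conversely, map a real sequence x to the homeomorphism h_x that fixes every
   1 - 2^-n and is affine on both halves of [1 - 2^-n, 1 - 2^-(n+1)], the ratio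
   of the two slopes being exp (x n). Then h_x and h_y have comparable increments
   iff x - y is bounded. The closed set h_x(B), where B consists of 1 and of the
   breakpoints, is well-ordered of type omega + 1, so an increasing homeomorphism
   from h_x(B) onto h_y(B) has to map breakpoints to breakpoints. *)

Require Import Defs.
From mathcomp Require Import finmap.
From mathcomp Require Import all_boot all_order all_algebra.
From mathcomp Require Import all_classical all_reals all_analysis.
From mathcomp Require Import measurable_realfun ring lra.
Import Order.TTheory GRing.Theory Num.Theory.
Import numFieldNormedType.Exports.

Set Implicit Arguments.
Unset Strict Implicit.
Unset Printing Implicit Defensive.

Local Open Scope classical_set_scope.
Local Open Scope ring_scope.

(** * Borel sets and Borel maps *)

Lemma open_borel (X : ptopologicalType) (U : set X) : open U ->
  measurable (U : set (borel_space X)).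
Proof. by move=> oU; apply: (@sub_sigma_algebra _ setT (@open X)). Qed.

Lemma borel_measurable_fun (X : ptopologicalType) d (T : measurableType d)
    (f : T -> X) :
  (forall U, open U -> measurable (f @^-1` U)) ->
  measurable_fun setT (f : T -> borel_space X).
Proof.
move=> fU; apply: (@measurability _ _ T (borel_space X) setT f (@open X)) =>
  // _ [U oU <-].
by rewrite setTI; exact: fU.
Qed.

Lemma continuous_borel (X Y : ptopologicalType) (f : Y -> X) : continuous f ->
  measurable_fun setT (f : borel_space Y -> borel_space X).
Proof.
move=> /continuousP cf; apply: borel_measurable_fun => U oU.
by apply: open_borel; exact: cf.
Qed.

Lemma continuous_borel_real (X : ptopologicalType) (R : realType) (f : X -> R) :
  continuous f ->
  measurable_fun setT (f : borel_space X -> R).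
Proof.
move=> /continuousP cf; apply: (measurability _ (RGenOpens.measurableE R)).
move=> _ [_ [a [b ->]] <-]; rewrite setTI.
by apply: open_borel; apply: cf; exact: itv_open.
Qed.

(** * Borel maps into the space of real sequences *)

Section ptws.
Variable R : realType.

Lemma cvg_ptws_seq (T : Type) (F : set_system T) (FF : Filter F)
    (f : T -> {ptws nat -> R}) (l : {ptws nat -> R}) :
  (forall i, (fun t => f t i) @ F --> l i) -> f @ F --> l.
Proof. by move=> fl; apply/(@pointwise_cvgP nat R) => i; exact: fl. Qed.

(** If every [N] failed, the counterexamples would converge to [z] coordinate by coordinate, so they
    would eventually enter [U]. *)
Lemma ptws_nbhs_box (U : set {ptws nat -> R}) (z : {ptws nat -> R}) :
  open U -> U z -> exists N : nat, forall z' : {ptws nat -> R},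
    (forall i, (i < N)%N -> `|z' i - z i| < N.+1%:R^-1) -> U z'.
Proof.
move=> oU Uz; apply: contrapT => /forallNP nU.
have /choice[v vP] N : exists z' : {ptws nat -> R},
    (forall i, (i < N)%N -> `|z' i - z i| < N.+1%:R^-1) /\ ~ U z'.
  by have /existsNP[z' /not_implyP] := nU N; exists z'.
have vz : v n @[n --> \oo] --> z.
  apply: cvg_ptws_seq => i; apply/cvgrPdist_lt => e e0.
  near=> n; rewrite distrC; apply: (@lt_trans _ _ n.+1%:R^-1).
    by apply: (vP n).1; near: n; exact: nbhs_infty_gt.
  by near: n; exact: near_infty_natSinv_lt (PosNum e0).
have : \forall n \near \oo, U (v n) by apply: vz; exact: open_nbhs_nbhs.
by case=> N _ /(_ N (leqnn N)); exact: (vP N).2.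
Unshelve. all: by end_near. Qed.

(** The product is second countable: an open set is the union of the countably many boxes with
    rational centres that it contains. *)
Lemma measurable_ptws d (T : measurableType d) (f : T -> {ptws nat -> R}) :
  (forall i, measurable_fun setT (fun t => f t i)) ->
  measurable_fun setT (f : T -> borel_space {ptws nat -> R}).
Proof.
move=> mf; apply: borel_measurable_fun => U oU.
(* The length of [s] fixes both the number of constrained coordinates and the radius. The radius is
   half that of [ptws_nbhs_box], which leaves room for the distance from the point to the rational
   centre. *)
pose box (s : seq rat) : set {ptws nat -> R} := [set z |
  forall i, (i < size s)%N ->
    `|z i - ratr (nth 0 s i)| < ((size s).+1%:R^-1) / 2].
have -> : f @^-1` U = \bigcup_(s : seq rat)
    (if `[< box s `<=` U >] then f @^-1` box s else set0).
  apply/seteqP; split=> [t Uft|t [s _]]; last by case: asboolP => // + bt;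
    exact.
  have [N NU] := ptws_nbhs_box oU Uft.
  have /choice[q qP] i : exists q : rat, `|f t i - ratr q| < N.+1%:R^-1 / 2.
    have : f t i - N.+1%:R^-1 / 2 < f t i + N.+1%:R^-1 / 2.
      by rewrite ltrBlDr -addrA ltrDl addr_gt0 ?divr_gt0.
    case/rat_in_itvoo => q; rewrite in_itv/= => /andP[q1 q2]; exists q.
    move: q1 q2; set a := _ / 2 => q1 q2; rewrite ltr_norml; apply/andP; split;
      lra.
  have sq : size (mkseq q N) = N by rewrite size_mkseq.
  exists (mkseq q N) => //; case: asboolP => [_|] /=.
    by move=> i; rewrite sq => iN; rewrite nth_mkseq.
  case=> z; rewrite /box/= sq => zb; apply: NU => i iN.
  have := zb i iN; have := qP i; rewrite nth_mkseq// => h1 h2.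
  rewrite (le_lt_trans (ler_distD (ratr (q i)) _ _))// (distrC (ratr _)).
  by rewrite (splitr N.+1%:R^-1) ltrD.
apply: countable_bigcupT_measurable => [|s]; first exact: countableP.
case: asboolP => // _.
have -> : f @^-1` box s = \bigcap_(i in [set i | (i < size s)%N])
    ((fun t => f t i) @^-1` ball (ratr (nth 0 s i) : R) ((size s).+1%:R^-1 /
      2)).
  by apply/seteqP; split=> t ft i si; have := ft i si; rewrite /ball/= distrC.
apply: bigcap_measurableType => i _; rewrite -[X in measurable X]setTI.
by apply: mf => //; rewrite ball_itv; exact: measurable_itv.
Qed.

Lemma ell_inftyP (x y : {ptws nat -> R}) :
  ell_infty x y <-> exists M, forall n, `|x n - y n| <= M.
Proof.
rewrite /ell_infty; split=> [h|[M xyM]]; last first.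
  apply: (@le_lt_trans _ _ M%:E); last exact: ltry.
  by apply: ge_ereal_sup => _ [n _ <-]; rewrite lee_fin.
have h0 n : (`|x n - y n|%:E <= ereal_sup (range (fun n => `|x n - y n|%:E)))%E.
  by apply: ereal_sup_ubound; exists n.
case: (ereal_sup _) h h0 => [M||]// _ h0.
  by exists M => n; rewrite -lee_fin; exact: h0.
by have := h0 0%N; rewrite leeNy_eq.
Qed.

(** The index set is embedded into [nat] by [pickle]. Integers that code no index receive the
    coordinate 0 at every point, which does not affect differences. *)
Lemma borel_reducible_ell_infty (X : ptopologicalType) (E : X -> X -> Prop)
    (K : countType) (z : K -> X -> R) :
  (forall k, measurable_fun setT (z k : borel_space X -> R)) ->
  (forall x y, E x y <-> exists M, forall k, `|z k x - z k y| <= M) ->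
  borel_reducible E (@ell_infty R).
Proof.
move=> mz Ez.
exists (fun x n => if unpickle n is Some k then z k x else 0); split.
  apply: (@measurable_ptws _ (borel_space X)) => n.
  by case: (unpickle n) => [k|]; [exact: mz|exact: measurable_cst].
move=> x y; rewrite Ez ell_inftyP; split=> -[M xyM].
  (* If [K] is empty, [M] may be negative. *)
  exists (Num.max M 0) => n; case: (unpickle n) => [k|]; rewrite le_max ?xyM//.
  by rewrite subrr normr0 lexx orbT.
by exists M => k; have := xyM (pickle k); rewrite pickleK.
Qed.

End ptws.

(** * Increasing homeomorphisms of the unit interval *)

Section unit_interval.
Variable R : realType.

Local Notation I := (unit_interval R).

Lemma set_val_itv01 (x : I) : 0 <= set_val x <= 1.
Proof. by case: x => x; rewrite set_valE/= inE/= in_itv. Qed.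

Lemma set_val_inj : injective (set_val : I -> R).
Proof. by move=> x y; rewrite set_valE => /val_inj. Qed.

Lemma set_val_continuous : continuous (set_val : I -> R).
Proof. exact: initial_continuous. Qed.

Lemma near_set_val (x : I) (e : R) : 0 < e ->
  \forall y \near x, `|set_val x - set_val y| < e.
Proof.
move=> e0; have xc : set_val y @[y --> x] --> set_val x.
  exact: set_val_continuous.
exact: (iffLR (@cvgrPdist_lt _ _ _ (nbhs x) _ _ _) xc).
Qed.

Lemma cvg_set_val (T : Type) (F : set_system T) (FF : Filter F) (f : T -> I)
    (x : I) :
  (forall e, 0 < e -> \forall t \near F, `|set_val x - set_val (f t)| < e) ->
  f @ F --> x.
Proof.
move=> /cvgrPdist_lt fx U [_ [[W oW <-]]] /= Wx /filterS; apply.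
by apply: fx; exact: open_nbhs_nbhs.
Qed.

Lemma continuous_set_val (T : topologicalType) (f : T -> I) :
  (forall t e, 0 < e ->
    \forall s \near t, `|set_val (f t) - set_val (f s)| < e) -> continuous f.
Proof. by move=> cf t; apply: cvg_set_val => e; exact: cf. Qed.

Lemma clamp01_subproof (t : R) :
  Num.max 0 (Num.min t 1) \in (`[0, 1]%classic : set R).
Proof. by rewrite inE/= in_itv/= le_max lexx/= ge_max ler01 ge_min lexx orbT.
  Qed.

Definition clamp01 (t : R) : I := exist (fun x =>
  x \in _) _ (clamp01_subproof t).

Lemma clamp01K (t : R) : 0 <= t <= 1 -> set_val (clamp01 t) = t.
Proof.
by move=> /andP[t0 t1]; rewrite set_valE/= (min_idPl t1) (max_idPr t0).
Qed.

Lemma set_val_dist_le1 (x y : I) : `|set_val x - set_val y| <= 1.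
Proof.
have := set_val_itv01 x; have := set_val_itv01 y.
by rewrite ler_norml => /andP[? ?] /andP[? ?]; apply/andP; split; lra.
Qed.

Definition lipschitz_le (C : R) (f : I -> I) := forall x y : I,
  `|set_val (f x) - set_val (f y)| <= C * `|set_val x - set_val y|.

Lemma lipschitz_leW (C D : R) f :
  C <= D -> lipschitz_le C f -> lipschitz_le D f.
Proof. by move=> CD fC x y; rewrite (le_trans (fC x y))// ler_wpM2r. Qed.

Lemma lipschitz_le_comp (C D : R) f g : 0 <= C ->
  lipschitz_le C f -> lipschitz_le D g -> lipschitz_le (C * D) (f \o g).
Proof.
move=> C0 fC gD x y; rewrite (le_trans (fC _ _))// -mulrA.
by rewrite ler_wpM2l// gD.
Qed.

Lemma lipschitz_le_continuous (C : R) f : lipschitz_le C f -> continuous f.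
Proof.
move=> fC; apply: continuous_set_val => x e e0.
have C1 : 0 < `|C| + 1 by rewrite ltr_wpDl.
apply: filterS (near_set_val x (divr_gt0 e0 C1)) => y;
  rewrite ltr_pdivlMr// => xy.
rewrite (le_lt_trans (fC _ _))// (le_lt_trans _ xy)// mulrC ler_wpM2l//.
by rewrite (le_trans (ler_norm C))// lerDl.
Qed.

Section homeo.
Implicit Types f g h : incr_homeo R.

Lemma homeo_lt f (x y : I) :
  (set_val (f x) < set_val (f y)) = (set_val x < set_val y).
Proof.
apply/idP/idP; last exact: homeo_fun_incr.
rewrite !ltNge; apply: contra;
  rewrite le_eqVlt => /predU1P[/set_val_inj->//|yx].
exact/ltW/homeo_fun_incr.
Qed.

Lemma homeo_le f (x y : I) :
  (set_val (f x) <= set_val (f y)) = (set_val x <= set_val y).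
Proof. by rewrite !leNgt homeo_lt. Qed.

Lemma homeo_inv_incr f :
  {homo homeo_inv f : x y / set_val x < set_val y}.
Proof. by move=> x y xy; rewrite -(homeo_lt f) !homeo_invK. Qed.

Definition homeo_sym f : incr_homeo R := IncrHomeo (@homeo_invK _ f)
  (@homeo_funK _ f) (@homeo_inv_continuous _ f) (@homeo_fun_continuous _ f)
  (@homeo_inv_incr f).

Lemma homeo_comp_continuous (u v : I -> I) :
  continuous u -> continuous v -> continuous (u \o v).
Proof. by move=> cu cv x; apply: continuous_comp; [exact: cv|exact: cu]. Qed.

Definition homeo_comp f g : incr_homeo R := @IncrHomeo R
  (f \o g) (homeo_inv g \o homeo_inv f)
  (can_comp (@homeo_funK _ f) (@homeo_funK _ g))
  (can_comp (@homeo_invK _ g) (@homeo_invK _ f))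
  (homeo_comp_continuous (@homeo_fun_continuous _ f) (@homeo_fun_continuous _
    g))
  (homeo_comp_continuous (@homeo_inv_continuous _ g) (@homeo_inv_continuous _
    f))
  (fun x y xy => homeo_fun_incr f (homeo_fun_incr g xy)).

Lemma sup_dist_ub f g x : `|set_val (f x) - set_val (g x)| <= sup_dist f g.
Proof.
apply: sup_ubound; last by exists x.
by exists 1 => _ [y _ <-]; exact: set_val_dist_le1.
Qed.

Lemma sup_dist_le f g M :
  (forall x, `|set_val (f x) - set_val (g x)| <= M) -> sup_dist f g <= M.
Proof.
move=> fgM; apply: ge_sup; last by move=> _ [x _ <-].
by exists `|set_val (f (clamp01 0)) - set_val (g (clamp01 0))|, (clamp01 0).
Qed.

Lemma near_sup_dist f e : 0 < e -> \forall g \near f, sup_dist f g < e.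
Proof.
move=> e0; have := nbhsx_ballx f _ e0; apply: filterS => g.
by rewrite ballEmdist.
Qed.

Lemma eval_continuous x : continuous (fun h : incr_homeo R => h x).
Proof.
apply: continuous_set_val => h e e0.
by apply: filterS (near_sup_dist h e0) => g; exact/le_lt_trans/sup_dist_ub.
Qed.

Lemma set_val_eval_continuous x :
  continuous (fun h : incr_homeo R => set_val (h x) : R).
Proof.
move=> h; apply/(@cvgrPdist_lt _ _ _ (nbhs h)) => e e0.
by apply: filterS (near_sup_dist h e0) => g; exact/le_lt_trans/sup_dist_ub.
Qed.

Lemma homeo_continuous (T : topologicalType) (F : T -> incr_homeo R) :
  (forall t e, 0 < e -> \forall s \near t, sup_dist (F t) (F s) <= e) ->
  continuous F.
Proof.
move=> h t; apply/cvg_ballP => e e0.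
apply: filterS (h t (e / 2) _) => [s ts|]; last exact: divr_gt0.
by rewrite ballEmdist/= (le_lt_trans ts)// ltr_pdivrMr// ltr_pMr// ltr1n.
Qed.

(** The only candidate for the Lipschitz map is [h2] composed with the inverse of [h1]; the
    substitution of [h1 x] for the variable turns its Lipschitz bounds into a comparison of
    increments. *)
Lemma ES_LipP h1 h2 : ES_Lip h1 h2 <-> exists C : R, forall x y : I,
  `|set_val (h2 x) - set_val (h2 y)| <=
    C * `|set_val (h1 x) - set_val (h1 y)| /\
  `|set_val (h1 x) - set_val (h1 y)| <=
    C * `|set_val (h2 x) - set_val (h2 y)|.
Proof.
split=> [[g [[C gC] [D gD]] <-]|[C hC]].
  exists (Num.max C D) => x y; split.
    by apply: lipschitz_leW gC _ _; rewrite le_max lexx.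
  rewrite -{1}(homeo_funK g (h1 x)) -{1}(homeo_funK g (h1 y)).
  by apply: lipschitz_leW gD _ _; rewrite le_max lexx orbT.
exists (homeo_comp h2 (homeo_sym h1)); last by apply/funext => x/=;
  rewrite homeo_funK.
split; exists C => x y /=.
  by have := (hC (homeo_inv h1 x) (homeo_inv h1 y)).1; rewrite !homeo_invK.
by have := (hC (homeo_inv h2 x) (homeo_inv h2 y)).2; rewrite !homeo_invK.
Qed.

End homeo.

End unit_interval.

(** * Reducing E^S to bounded distance of sequences *)

Section ES_to_ell_infty.
Variable R : realType.

Local Notation I := (unit_interval R).

Definition grid (p : nat * nat) : I := clamp01 (p.1%:R / p.2.+1%:R).

(** The number [x] is approximated from below by the integer part of [(n+1) x] divided by [n+1],
    with an error of at most [1/(n+1)]. *)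
Lemma grid_dense (x : I) :
  exists u : nat -> nat * nat, grid (u n) @[n --> \oo] --> x.
Proof.
have /andP[x0 x1] := set_val_itv01 x.
exists (fun n => (Num.trunc (n.+1%:R * set_val x), n)).
apply: cvg_set_val => e e0; near=> n.
have n0 : 0 < n.+1%:R :> R by [].
have nx0 : 0 <= n.+1%:R * set_val x by rewrite mulr_ge0.
have /andP[t1 t2] := truncn_itv nx0.
rewrite /grid clamp01K/=; last first.
  rewrite divr_ge0//= ler_pdivrMr// mul1r (le_trans t1)//.
  by rewrite ler_piMr.
rewrite ger0_norm; last first.
  by rewrite subr_ge0 ler_pdivrMr// [leRHS]mulrC.
apply: (@le_lt_trans _ _ n.+1%:R^-1); last first.
  by near: n; exact: near_infty_natSinv_lt (PosNum e0).
rewrite lerBlDr -[X in _ <= X + _]mul1r -mulrDl ler_pdivlMr//.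
by rewrite mulrC (le_trans (ltW t2))// -natr1 addrC.
Unshelve. all: by end_near. Qed.

(** Both sides are continuous in [x] and [y], and the grid is dense. *)
Lemma ler_dist_grid (C : R) (h1 h2 : incr_homeo R) :
  (forall p q, `|set_val (h2 (grid p)) - set_val (h2 (grid q))| <=
           C * `|set_val (h1 (grid p)) - set_val (h1 (grid q))|) ->
  forall x y, `|set_val (h2 x) - set_val (h2 y)| <=
          C * `|set_val (h1 x) - set_val (h1 y)|.
Proof.
move=> hC x y; have [u ux] := grid_dense x; have [v vy] := grid_dense y.
have hcvg (h : incr_homeo R) z w : grid (w n) @[n --> \oo] --> z ->
    set_val (h (grid (w n))) @[n --> \oo] --> set_val (h z).
  move=> wz; apply: (@cvg_comp _ _ _ (h \o grid \o w) set_val).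
    apply: (@cvg_comp _ _ _ (grid \o w) h); first exact: wz.
    exact: homeo_fun_continuous.
  exact: set_val_continuous.
have dcvg (h : incr_homeo R) :
    `|set_val (h (grid (u n))) - set_val (h (grid (v n)))| @[n --> \oo] -->
    (`|set_val (h x) - set_val (h y)| : R).
  by apply: cvg_norm; apply: cvgB; exact: hcvg.
apply: (ler_cvg_to (dcvg h2) (cvgMl_tmp (dcvg h1))); apply: nearW => n;
  exact: hC.
Qed.

Lemma ln_dist_le (C a b : R) : 0 < C -> 0 < a -> 0 < b ->
  (`|ln a - ln b| <= ln C) <-> (a <= C * b /\ b <= C * a).
Proof.
move=> C0 a0 b0.
rewrite -(ler_ln (x := a)) -1?(ler_ln (x := b)) ?posrE ?mulr_gt0// !lnM//.
rewrite ler_norml; split=> [/andP[? ?]|[? ?]]; first by split; lra.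
by apply/andP; split; lra.
Qed.

Lemma ES_Lip_le_ell_infty : borel_reducible (@ES_Lip R) (@ell_infty R).
Proof.
pose dist (p q : nat * nat) (h : incr_homeo R) :=
  `|set_val (h (grid p)) - set_val (h (grid q))|.
have dist0 p q : grid p = grid q -> forall h, dist p q h = 0.
  by move=> pq h; rewrite /dist pq subrr normr0.
have dist_gt0 p q : grid p != grid q -> forall h, 0 < dist p q h.
  move=> pq h; rewrite normr_gt0 subr_eq0; apply: contra pq => /eqP.
  by move=> /set_val_inj/(can_inj (homeo_funK h)) ->.
apply: (@borel_reducible_ell_infty R _ _ ((nat * nat) * (nat * nat))%type
  (fun k h => ln (dist k.1 k.2 h))) => [[p q]|h1 h2] /=.
  apply: continuous_borel_real => h.
  (* Distinct indices may give the same grid point. The coordinate is then the constant [ln 0],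
     which is continuous and cancels in differences. *)
  have [pq|pq] := eqVneq (grid p) (grid q).
    rewrite (_ : (fun _ => _) = cst (ln 0));
      first exact: (@cst_continuous (incr_homeo R) R (ln 0)).
    by apply/funext => g; rewrite dist0.
  have dc : dist p q g @[g --> h] --> dist p q h.
    have := @set_val_eval_continuous R (grid q) h.
    have := @set_val_eval_continuous R (grid p) h.
    by move=> cp cq; exact: (cvg_norm (cvgB cp cq)).
  apply: (cvg_comp _ _ dc).
  by apply: continuous_ln; exact: dist_gt0.
split=> [/ES_LipP[C hC]|[M hM]].
  (* The maximum with 1 makes the constant positive and its logarithm nonnegative; the latter covers
     the coinciding grid points. *)
  have C0 : 0 < Num.max C 1 by rewrite lt_max ltr01 orbT.
  have CW (a b : R) : a <= C * `|b| -> a <= Num.max C 1 * `|b|.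
    by move=> /le_trans; apply; rewrite ler_wpM2r// le_max lexx.
  exists (ln (Num.max C 1)) => -[p q] /=.
  have [pq|pq] := eqVneq (grid p) (grid q).
    by rewrite !dist0// subrr normr0 ln_ge0// le_max lexx orbT.
  apply/ln_dist_le; rewrite ?dist_gt0//.
  have [h21 h12] := hC (grid p) (grid q).
  by split; exact: CW.
have {}hM p q : dist p q h1 <= expR M * dist p q h2 /\
    dist p q h2 <= expR M * dist p q h1.
  have [pq|pq] := eqVneq (grid p) (grid q); first by rewrite !dist0// mulr0.
  apply/ln_dist_le; rewrite ?dist_gt0 ?expR_gt0// expRK.
  exact: (hM (p, q)).
apply/ES_LipP; exists (expR M) => x y; split.
  by apply: ler_dist_grid => p q; exact: (hM p q).2.
by apply: ler_dist_grid => p q; exact: (hM p q).1.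
Qed.

End ES_to_ell_infty.

(** * Reducing E^H to bounded distance of sequences *)

Section vietoris_topology.
Variable T : topologicalType.

Lemma vietoris_subbase_open (A : set (closed_subset T)) :
  vietoris_subbase A -> open A.
Proof.
move=> bA; exists [set A]; last by rewrite bigcup_set1.
move=> _ ->; exists [fset A]%fset; first by move=> B /fset1P ->; rewrite inE.
by rewrite set_fset1 bigcap_set1.
Qed.

Lemma open_vietoris_sub (U : set T) : open U ->
  open [set F : closed_subset T | F `<=` U].
Proof. by move=> oU; apply: vietoris_subbase_open; left; exists U. Qed.

Lemma open_vietoris_meet (U : set T) : open U ->
  open [set F : closed_subset T | F `&` U !=set0].
Proof. by move=> oU; apply: vietoris_subbase_open; right; exists U. Qed.

(** A filter is stable under finite intersections and supersets, so it is enough to test it on the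
    subbase. *)
Lemma cvg_vietoris (G : set_system (closed_subset T)) (F : closed_subset T) :
  Filter G ->
  (forall U, open U -> F `<=` U -> G [set E | closed_subset_set E `<=` U]) ->
  (forall U, open U -> F `&` U !=set0 ->
    G [set E | closed_subset_set E `&` U !=set0]) ->
  G --> F.
Proof.
move=> FG Gsub Gmeet A; rewrite nbhsE => -[_ [[B sB <-] [C BC CF]] sUBA].
apply: filterS sUBA _; apply: (@filterS _ _ _ C); first by move=> ? ?; exists C.
have [D sD IDeC] := sB _ BC; rewrite -IDeC; apply: filter_bigI => E DE.
have EF : E F by move: CF; rewrite -IDeC => /(_ _ DE).
have := sD _ DE; rewrite inE => -[[U oU UE]|[U oU UE]]; move: EF; rewrite -UE.
  exact: Gsub.
exact: Gmeet.
Qed.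

End vietoris_topology.

Lemma ultra_fmap (T U : Type) (f : T -> U) (F : set_system T) :
  UltraFilter F -> UltraFilter (f @ F).
Proof.
move=> FU; split; first exact: fmap_proper_filter.
move=> G PG FG; apply/seteqP; split=> // A GA.
have [//|nA] := @in_ultra_setVsetC _ F (f @^-1` A) FU.
have GnA : G (~` A) by apply: FG.
by case: (@filter_ex _ G _ _ (filterI GA GnA)) => x [].
Qed.

Section EH_to_ell_infty.
Variable R : realType.

Local Notation I := (unit_interval R).

(** This is the set L_k. With powers of 2 as constants, composition adds the indices. *)
Definition bilipschitz (k : nat) (g : incr_homeo R) :=
  lipschitz_le (2 ^+ k : R) g /\ lipschitz_le (2 ^+ k : R) (homeo_inv g).

Lemma expr2_ge_nat (n : nat) : (n%:R : R) <= 2 ^+ n.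
Proof. by rewrite -natrX ler_nat ltnW// ltn_expl. Qed.

Lemma lipschitz_expr2 f : lipschitz_unit f ->
  exists k, lipschitz_le (2 ^+ k : R) f.
Proof.
move=> [C fC]; exists (Num.trunc `|C|).+1; apply: lipschitz_leW fC.
rewrite (le_trans (ler_norm C))//.
by rewrite (le_trans _ (expr2_ge_nat _))// ltW// truncnS_gt.
Qed.

Lemma bilipschitzW (j k : nat) g :
  (j <= k)%N -> bilipschitz j g -> bilipschitz k g.
Proof.
by move=> jk [g1 g2]; split; [apply: lipschitz_leW g1|apply: lipschitz_leW g2];
  rewrite ler_weXn2l// ler1n.
Qed.

Lemma Lip_bilipschitz g : Lip g -> exists k, bilipschitz k g.
Proof.
move=> [/lipschitz_expr2[j gj] /lipschitz_expr2[k gk]]; exists (maxn j k).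
by split; [apply: lipschitz_leW gj|apply: lipschitz_leW gk];
  rewrite ler_weXn2l ?ler1n// ?leq_maxl ?leq_maxr.
Qed.

Lemma bilipschitz_Lip k g : bilipschitz k g -> Lip g.
Proof. by move=> [g1 g2]; split; exists (2 ^+ k). Qed.

Lemma bilipschitz_comp j k f g : bilipschitz j f -> bilipschitz k g ->
  bilipschitz (j + k) (homeo_comp f g).
Proof.
move=> [f1 f2] [g1 g2]; split; rewrite exprD; first exact: lipschitz_le_comp.
by rewrite mulrC; exact: lipschitz_le_comp.
Qed.

Lemma bilipschitz_id k : bilipschitz k (incr_homeo_id R).
Proof. by split=> x y /=; rewrite ler_peMl// exprn_ege1// ler1n. Qed.

(** The centres are spaced by exactly the radius, so the balls with [i <= n+1] cover the
    interval. *)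
Definition grid_ball (n i : nat) : set I :=
  [set x | `|set_val x - i%:R / n.+1%:R| < n.+1%:R^-1].

(* The sets F such that [traces n s F] form a basic open set of the Vietoris
   topology, whose members are 2/(n+1)-close for the Hausdorff distance. *)
Definition traces (n : nat) (s : seq nat) (F : set I) :=
  F `<=` \bigcup_(i in [set` s]) grid_ball n i /\
  forall i, i \in s -> F `&` grid_ball n i !=set0.

Definition traces_orbit (n : nat) (s : seq nat) (k : nat) :
  set (closed_subset I) :=
  [set F : closed_subset I | exists2 g, bilipschitz k g & traces n s (g @` F)].

Lemma open_grid_ball n i : open (grid_ball n i).
Proof.
rewrite (_ : grid_ball n i =
    set_val @^-1` ball (i%:R / n.+1%:R : R) n.+1%:R^-1); last first.
  by apply/seteqP; split=> x; rewrite /grid_ball /ball/= distrC.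
have /continuousP := @set_val_continuous R; apply; exact: ball_open.
Qed.

(** For each [g] the condition on [F] is a finite intersection of subbasic open sets, taken at
    preimages under [g]. The union over [g] is uncountable, but a union of open sets is open. *)
Lemma open_traces_orbit n s k : open (traces_orbit n s k).
Proof.
rewrite (_ : traces_orbit n s k = \bigcup_(g in bilipschitz k)
    ([set F : closed_subset I | F `<=` g @^-1` (\bigcup_(i in [set` s])
      grid_ball n i)] `&`
    \bigcap_(i in [set` s])
      [set F : closed_subset I | F `&` (g @^-1` grid_ball n i) !=set0])).
  apply: bigcup_open => g _.
  have go U : open U -> open (g @^-1` U).
    by have /continuousP := @homeo_fun_continuous _ g; apply.
  apply: openI; last first.
    rewrite bigcap_seq; apply: big_ind => [||i _]; [exact: openT|exact: openI|].
    by apply: open_vietoris_meet; apply: go; exact: open_grid_ball.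
  apply: open_vietoris_sub; apply: go; apply: bigcup_open => i _.
  exact: open_grid_ball.
apply/seteqP; split=> F [g gk].
  move=> [FU FJ]; exists g => //; split=> [x Fx|i si]; first by apply: FU;
    exists x.
  by have [_ [[x Fx <-] gx]] := FJ i si; exists x.
move=> [FU FJ]; exists g => //; split=> [_ [x Fx <-]|i si]; first exact: FU.
by have [x [Fx gx]] := FJ i si; exists (g x); split => //; exists x.
Qed.

(* The distance, truncated at [k.2], from [F] to the basic open set of index
   [k.1], measured by the least [j] such that some [g] in L_j moves [F] there.
     *)
Definition traces_dist (k : nat * seq nat * nat) (F : closed_subset I) : R :=
  \sum_(j < k.2) \1_(~` traces_orbit k.1.1 k.1.2 j) F.

Lemma measurable_traces_dist k :
  measurable_fun setT (traces_dist k : borel_space (closed_subset I) -> R).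
Proof.
apply: measurable_sum => j; apply: measurable_indic; apply: measurableC.
by apply: open_borel; exact: open_traces_orbit.
Qed.

(** The first [j] terms on the left are at most 1 each, and the term of index [j + k] is at most the
    term of index [k] on the right. This is the Lipschitz property of the truncated distance along
    orbits. *)
Lemma sum_indicC_shift (T : Type) (P Q : nat -> set T) (x y : T) (j m : nat) :
  (forall k, P k x -> Q (j + k)%N y) ->
  \sum_(k < m) \1_(~` Q k) y <= j%:R + \sum_(k < m) \1_(~` P k) x :> R.
Proof.
move=> PQ; apply: (@le_trans _ _ (\sum_(k < j + m) \1_(~` Q k) y)).
  by rewrite addnC big_split_ord/= lerDl sumr_ge0.
rewrite big_split_ord/= lerD//.
  rewrite (_ : j%:R = \sum_(i < j) 1); last by rewrite sumr_const card_ord.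
  by apply: ler_sum => i _; rewrite indicE lern1 leq_b1.
apply: ler_sum => i _; rewrite !indicE ler_nat !in_setC.
case: (boolP (x \in P i)) => [/set_mem/PQ/mem_set ->//|_].
exact: leq_b1.
Qed.

(** A map that moves [F2] to the required place does so for [F1] after composition with [g]. *)
Lemma EH_Lip_bilipschitz k g (F1 F2 : closed_subset I) :
  bilipschitz k g -> g @` F1 = F2 ->
  forall n s j, traces_orbit n s j F2 -> traces_orbit n s (k + j) F1.
Proof.
move=> gk gF n s j [h hj]; rewrite -gF => hs.
exists (homeo_comp h g); first by rewrite addnC; exact: bilipschitz_comp.
by rewrite /= -image_comp.
Qed.

Lemma bilipschitz_sym k g : bilipschitz k g -> bilipschitz k (homeo_sym g).
Proof. by case. Qed.

(** If the map between the two sets lies in L_j, then [j] is a bound for all basic open sets and all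
    truncation levels at once. *)
Lemma traces_dist_bounded (F1 F2 : closed_subset I) :
  EH_Lip F1 F2 ->
  exists M, forall k, `|traces_dist k F1 - traces_dist k F2| <= M.
Proof.
move=> [g /Lip_bilipschitz[j gj] gF]; exists j%:R => -[[n s] m].
have gF' : homeo_sym g @` F2 = F1.
  by rewrite -gF image_comp (_ : _ \o _ = id) ?image_id//; apply/funext=> x/=;
     rewrite homeo_funK.
rewrite /traces_dist/= ler_distl; apply/andP; split.
  rewrite lerBlDl; apply: (@sum_indicC_shift _ (fun j =>
    traces_orbit n s j)) => k.
  by apply: (EH_Lip_bilipschitz (bilipschitz_sym gj)); exact: gF'.
rewrite addrC; apply: (@sum_indicC_shift _ (fun j => traces_orbit n s j)) => k.
exact: (EH_Lip_bilipschitz gj gF).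
Qed.

End EH_to_ell_infty.

(** * Limits of uniformly bi-Lipschitz maps along an ultrafilter *)

Section bilipschitz_limit.
Variables (R : realType) (U : set_system nat).
Hypothesis FU : UltraFilter U.

Local Notation I := (unit_interval R).

(** Compactness makes every sequence converge along one fixed ultrafilter, so a sequence of maps has
    a pointwise limit everywhere at once, without extraction of subsequences. *)
Lemma ultra_cvg_itv01 (u : nat -> I) :
  exists x : I, set_val (u n) @[n --> U] --> (set_val x : R).
Proof.
have := @segment_compact R 0 1; rewrite compact_ultra.
move=> /(_ (set_val (u n) @[n --> U]) (ultra_fmap _ FU)).
have u01 : \forall n \near U, 0 <= set_val (u n) <= 1.
  by apply: nearW => n; exact: set_val_itv01.
case=> [|x /= [x01 ux]].
  by apply: filterS u01 => n; rewrite /= in_itv.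
by exists (clamp01 x); rewrite clamp01K.
Qed.

Lemma lipschitz_le_lim (C : R) (u : nat -> I -> I) (v : I -> I) :
  (forall n, lipschitz_le C (u n)) ->
  (forall x, set_val (u n x) @[n --> U] --> (set_val (v x) : R)) ->
  lipschitz_le C v.
Proof.
move=> uC uv x y.
have duv : `|set_val (u n x) - set_val (u n y)| @[n --> U] -->
    (`|set_val (v x) - set_val (v y)| : R).
  exact: (cvg_norm (cvgB (uv x) (uv y))).
by apply: (cvgr_to_le duv); apply: nearW => n; exact: uC.
Qed.

(** As [x = u' n (u n x)], the distance from [u' n (v x)] to [x] is at most [C] times that from
    [v x] to [u n x], which tends to 0. *)
Lemma cancel_lim (C : R) (u u' : nat -> I -> I) (v v' : I -> I) :
  (forall n, lipschitz_le C (u' n)) -> (forall n, cancel (u n) (u' n)) ->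
  (forall x, set_val (u n x) @[n --> U] --> (set_val (v x) : R)) ->
  (forall x, set_val (u' n x) @[n --> U] --> (set_val (v' x) : R)) ->
  cancel v v'.
Proof.
move=> u'C uK uv u'v' x; apply: set_val_inj; apply/eqP.
rewrite -subr_eq0 -normr_eq0 eq_le normr_ge0 andbT.
have dl : `|set_val (u' n (v x)) - set_val x| @[n --> U] -->
    (`|set_val (v' (v x)) - set_val x| : R).
  exact: (cvg_norm (cvgB (u'v' (v x)) (cvg_cst _))).
have dr : C * `|set_val (v x) - set_val (u n x)| @[n --> U] -->
    (C * `|set_val (v x) - set_val (v x)| : R).
  exact: (cvgMl_tmp (cvg_norm (cvgB (cvg_cst _) (uv x)))).
have := ler_cvg_to dl dr; rewrite subrr normr0 mulr0; apply.
by apply: nearW => n; rewrite -{2}(uK n x); exact: u'C.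
Qed.

Lemma closed_lim (F : set I) (e : nat -> R) (u : nat -> I) (x : I) : closed F ->
  (e n @[n --> U] --> (0 : R)) ->
  (forall n, exists2 y, F y & `|set_val (u n) - set_val y| <= e n) ->
  set_val (u n) @[n --> U] --> (set_val x : R) -> F x.
Proof.
move=> cF e0 Fu ux.
have /choice[y yP] n : exists y, F y /\ `|set_val (u n) - set_val y| <= e n.
  by have [y] := Fu n; exists y.
apply: (@closed_cvg _ _ U _ y F cF); first by apply: nearW => n;
  exact: (yP n).1.
apply: cvg_set_val => d d0.
have d20 : 0 < d / 2 by rewrite divr_gt0.
have ud := (iffLR (@cvgrPdist_lt _ _ _ U _ _ _) ux) _ d20.
have ed := (iffLR (@cvgrPdist_lt _ _ _ U _ _ _) e0) _ d20.
near=> n; have un : `|set_val x - set_val (u n)| < d / 2.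
  by near: n; exact: ud.
have : `|0 - e n| < d / 2 by near: n; exact: ed.
rewrite sub0r normrN => en.
rewrite (le_lt_trans (ler_distD (set_val (u n)) _ _))// (splitr d) ltrD//.
by rewrite (le_lt_trans (yP n).2)// (le_lt_trans (ler_norm _)).
Unshelve. all: by end_near. Qed.

End bilipschitz_limit.

(** * Compactness of L_m and the reduction of E^H *)

Section EH_to_ell_infty.
Variable R : realType.

Local Notation I := (unit_interval R).

(** The maps [g n] and their inverses have limits along an ultrafilter; the uniform bounds keep
    these limits Lipschitz and inverse to each other, and closedness of [F1] and [F2] absorbs the
    vanishing errors. *)
Lemma bilipschitz_compact m (g : nat -> incr_homeo R) (F1 F2 : closed_subset I)
    (e : nat -> R) :
  (forall n, bilipschitz m (g n)) -> e n @[n --> \oo] --> (0 : R) ->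
  (forall n x, closed_subset_set F1 x -> exists2 y, closed_subset_set F2 y &
    `|set_val (g n x) - set_val y| <= e n) ->
  (forall n y, closed_subset_set F2 y -> exists2 x, closed_subset_set F1 x &
    `|set_val (g n x) - set_val y| <= e n) ->
  EH_Lip F1 F2.
Proof.
move=> gm e0 g12 g21.
have [U [FU ooU]] := @ultraFilterLemma _ (\oo : set_system nat) _.
have {}e0 : e n @[n --> U] --> (0 : R) by apply: cvg_trans e0; exact: cvg_app.
have /choice[f gf] x := ultra_cvg_itv01 FU (fun n => g n x).
have /choice[f' gf'] x := ultra_cvg_itv01 FU (fun n => homeo_inv (g n) x).
have C0 : 0 <= 2 ^+ m :> R by rewrite exprn_ge0.
have fC := lipschitz_le_lim FU (fun n => (gm n).1) gf.
have f'C := lipschitz_le_lim FU (fun n => (gm n).2) gf'.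
have fK : cancel f f'.
  exact: (cancel_lim FU (fun n => (gm n).2) (fun n =>
    @homeo_funK _ (g n)) gf gf').
have f'K : cancel f' f.
  exact: (cancel_lim FU (fun n => (gm n).1) (fun n =>
    @homeo_invK _ (g n)) gf' gf).
have f_incr : {homo f : x y / set_val x < set_val y}.
  (* The limit preserves only the weak inequality; strictness comes from the injectivity of [f]. *)
  move=> x y xy; rewrite lt_neqAle; apply/andP; split.
    by apply: contraTN xy => /eqP/set_val_inj/(can_inj fK) ->; rewrite ltxx.
  by apply: (ler_cvg_to (gf x) (gf y)); apply: nearW => n; rewrite homeo_le ltW.
pose h := IncrHomeo fK f'K (lipschitz_le_continuous fC)
  (lipschitz_le_continuous f'C) f_incr.
exists h; first exact: (@bilipschitz_Lip _ m).
apply/seteqP; split=> [_ [x F1x <-]|y F2y] /=.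
  apply: (closed_lim FU (@closed_subset_closed _ F2) e0 _ (gf x)) => n.
  exact: g12.
exists (f' y); last exact: f'K.
(* Pulling back by the inverse of [g n] multiplies the error by at most [2 ^+ m]. *)
apply: (closed_lim FU (@closed_subset_closed _ F1) _ _ (gf' y)).
  have := cvgMl_tmp (a := 2 ^+ m) e0; rewrite mulr0; exact.
move=> n; have [x F1x xy] := g21 n y F2y; exists x => //.
rewrite -{1}(homeo_funK (g n) x) (le_trans ((gm n).2 _ _))// ler_wpM2l//.
by rewrite distrC.
Qed.

Lemma EH_Lip_le_ell_infty : borel_reducible (@EH_Lip R) (@ell_infty R).
Proof.
apply: (borel_reducible_ell_infty (@measurable_traces_dist R)) => F1 F2.
split=> [|[M hM]]; first exact: traces_dist_bounded.
have [m Mm] : exists m : nat, M < m%:R.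
  exists (Num.trunc `|M|).+1; rewrite (le_lt_trans (ler_norm M))//.
  exact: truncnS_gt.
have trF2 n : exists s, traces n s F2.
  (* The trace of [F2] lists the balls that meet [F2]; the indices below [n.+2] already cover the
     interval. *)
  pose hit i := `[< F2 `&` @grid_ball R n i !=set0 >].
  have sE i : (i \in [seq j <- iota 0 n.+2 | hit j]) = hit i && (i < n.+2)%N.
    by rewrite mem_filter mem_iota.
  exists ([seq j <- iota 0 n.+2 | hit j]).
  split=> [x F2x|i]; last by rewrite sE => /andP[/asboolP].
  have /andP[x0 x1] := set_val_itv01 x.
  have nx0 : 0 <= n.+1%:R * set_val x by rewrite mulr_ge0.
  have /andP[t1 t2] := truncn_itv nx0.
  have gx : @grid_ball R n (Num.trunc (n.+1%:R * set_val x)) x.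
    rewrite /grid_ball/= ger0_norm; last first.
      by rewrite subr_ge0 ler_pdivrMr// [leRHS]mulrC.
    rewrite ltrBlDr -[X in _ < X + _]mul1r -mulrDl ltr_pdivlMr//.
    by rewrite mulrC (lt_le_trans t2)// -natr1 addrC.
  exists (Num.trunc (n.+1%:R * set_val x)); last exact: gx.
  apply: (etrans (sE _)); apply/andP; split; first by apply/asboolP; exists x.
  rewrite ltnS -(ler_nat R) (le_trans t1)//.
  by rewrite ler_piMr.
have /choice[g gP] n : exists g : incr_homeo R, bilipschitz m g /\
    exists2 s, traces n s F2 & traces n s (g @` F1).
  have [s sF2] := trF2 n.
  suff [g gm gs] : traces_orbit n s m F1 by exists g; split => //; exists s.
  (* Otherwise all [m] indicators are 1 at [F1], because L_i is contained in L_m for [i < m],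
     whereas they are all 0 at [F2] by means of the identity. The difference is then [m], which
     exceeds [M]. *)
  apply: contrapT => nF1; have := hM (n, s, m).
  rewrite /traces_dist/= (eq_bigr (fun=> 1)) => [|i _]; last first.
    rewrite indicE in_setC memNset//= => -[g gi gs]; apply: nF1.
    by exists g => //; apply: bilipschitzW gi; exact: ltnW.
  rewrite sumr_const card_ord big1 => [|i _]; last first.
    rewrite indicE in_setC mem_set//=.
    exists (incr_homeo_id R); first exact: bilipschitz_id.
    by rewrite /= image_id.
  rewrite subr0 ger0_norm//.
  by rewrite leNgt Mm.
(* Two points of the same [grid_ball n i] are less than [2/(n+1)] apart. *)
apply: (@bilipschitz_compact m g _ _ (fun n => n.+1%:R^-1 *+ 2)).
- by move=> n; exact: (gP n).1.
- rewrite -(mul0rn _ 2) mulr2n; under eq_fun do rewrite mulr2n.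
  by apply: cvgD; exact: cvg_harmonic.
- move=> n x F1x; have [_ [s [_ sF2] [sF1 _]]] := gP n.
  have [i /= si gi] : (\bigcup_(i in [set` s]) @grid_ball R n i) (g n x).
    by apply: sF1; exists x.
  have [y [F2y yi]] := sF2 i si; exists y => //.
  rewrite (le_trans (ler_distD (i%:R / n.+1%:R) _ _))// mulr2n lerD// ltW//.
  by rewrite distrC.
- move=> n y F2y; have [_ [s [sF2 _] [_ sF1]]] := gP n.
  have [i /= si gi] := sF2 y F2y.
  have [_ [[x F1x <-] xi]] := sF1 i si; exists x => //.
  rewrite (le_trans (ler_distD (i%:R / n.+1%:R) _ _))// mulr2n lerD// ltW//.
  by rewrite distrC.
Qed.

End EH_to_ell_infty.

(** * A family of piecewise linear homeomorphisms *)

Section ramp.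
Variable R : realType.
Implicit Types (u d t : R).

(** For [0 <= d] this is the length of the part of [[u, u + d]] to the left of [t]. *)
Definition ramp u d t := Num.max 0 (Num.min (t - u) d).

Lemma ramp_ge0 u d t : 0 <= ramp u d t.
Proof. by rewrite le_max lexx. Qed.

Lemma ramp_le u d t : 0 <= d -> ramp u d t <= d.
Proof. by move=> d0; rewrite ge_max d0 ge_min lexx orbT. Qed.

Lemma ramp_homo u d s t : s <= t -> ramp u d s <= ramp u d t.
Proof.
by move=> st; rewrite le_max2// le_min2// lerD2r.
Qed.

Lemma ramp_left u d t : t <= u -> ramp u d t = 0.
Proof. by move=> tu; apply/max_idPl; rewrite ge_min subr_le0 tu. Qed.

Lemma ramp_right u d t : 0 <= d -> u + d <= t -> ramp u d t = d.
Proof.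
by move=> d0 ut; rewrite /ramp (min_idPr _) ?(max_idPr _)// lerBrDl.
Qed.

Lemma rampD u d d' t : 0 <= d -> 0 <= d' ->
  ramp u d t + ramp (u + d) d' t = ramp u (d + d') t.
Proof.
move=> d0 d'0; rewrite /ramp.
case: (lerP (t - u) d) => ?; case: (lerP (t - (u + d)) d') => ?;
case: (lerP (t - u) (d + d')) => ?; do ?case: (lerP 0) => ?; lra.
Qed.

End ramp.

Section dyadic.
Variable R : realType.

Definition dyad (n : nat) : R := 1 - 2^-1 ^+ n.

(** Half the length of [[dyad n, dyad n.+1]]. *)
Definition hstep (n : nat) : R := 2^-1 ^+ n.+2.

Lemma hstep_gt0 n : 0 < hstep n.
Proof. by rewrite exprn_gt0// invr_gt0. Qed.

Lemma hstep_ge0 n : 0 <= hstep n. Proof. exact/ltW/hstep_gt0. Qed.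

Lemma dyad0 : dyad 0 = 0. Proof. by rewrite /dyad expr0 subrr. Qed.

Lemma dyadS n : dyad n.+1 = dyad n + hstep n + hstep n.
Proof. by rewrite /dyad /hstep !exprS; set z := 2^-1 ^+ n; lra. Qed.

Lemma dyad_lt1 n : dyad n < 1.
Proof. by rewrite /dyad ltrBlDr ltrDl exprn_gt0// invr_gt0. Qed.

Lemma dyad_le m n : (m <= n)%N -> dyad m <= dyad n.
Proof.
by move=> mn; rewrite /dyad lerD2l lerN2 ler_wiXn2l// ?invr_ge0// invf_le1//
  ler1n.
Qed.

Lemma dyad_ge0 n : 0 <= dyad n.
Proof. by rewrite -dyad0 dyad_le. Qed.

Lemma hstep_le2 n : 2 * hstep n <= 1.
Proof.
have := dyadS n; have := dyad_lt1 n.+1; have := dyad_ge0 n; lra.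
Qed.

Lemma cvg_dyad : dyad n @[n --> \oo] --> (1 : R).
Proof.
rewrite -[X in _ --> X](subr0 1); apply: cvgB; first exact: cvg_cst.
by apply: cvg_expr; rewrite gtr0_norm ?invr_gt0// invf_lt1// ltr1n.
Qed.

End dyadic.

Section piecewise_linear.
Variable R : realType.
Implicit Types (a : nat -> R).

Definition in01 a := forall n, 0 < a n < 1.

(* [2 * ramp u d] is the primitive vanishing at 0 of twice the indicator of
   [u, u + d]; hence [pl a] has slopes [2 * a n] and [2 * (1 - a n)] on the two
   halves of [dyad n, dyad n.+1], and it is the identity of [0, 1] when [a] is
   constantly 1/2. *)
Definition pl_term a n t : R := 2 * (a n * ramp (dyad R n) (hstep R n) t +
  (1 - a n) * ramp (dyad R n + hstep R n) (hstep R n) t).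

Definition pl_sum a N t : R := \sum_(n < N) pl_term a n t.

Definition pl a t : R := limn (pl_sum a ^~ t).

(** Both increments combine the same two nonnegative ramp increments, so comparing the coefficients
    is enough. *)
Lemma pl_term_le a a' C n s t :
  a n <= C * a' n -> 1 - a n <= C * (1 - a' n) -> s <= t ->
  pl_term a n t - pl_term a n s <= C * (pl_term a' n t - pl_term a' n s).
Proof.
move=> aC a1C st.
have := ramp_homo (dyad R n) (hstep R n) st.
have := ramp_homo (dyad R n + hstep R n) (hstep R n) st.
rewrite /pl_term -![_ <= ramp _ _ t]subr_ge0.
set r := ramp _ _ s; set r' := ramp _ _ t; set q := ramp _ _ s.
set q' := ramp _ _ t => rr qq; nra.
Qed.

Lemma pl_sum_le a a' C N s t :
  (forall n, (n < N)%N -> a n <= C * a' n /\ 1 - a n <= C * (1 - a' n)) ->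
  s <= t ->
  pl_sum a N t - pl_sum a N s <= C * (pl_sum a' N t - pl_sum a' N s).
Proof.
move=> aC st; rewrite /pl_sum -!sumrB mulr_sumr; apply: ler_sum => n _.
by apply: pl_term_le => //; have [] := aC n (ltn_ord n).
Qed.

Section weights.
Variables (a : nat -> R) (a01 : in01 a).

Lemma pl_term_homo n s t : s <= t -> pl_term a n s <= pl_term a n t.
Proof.
have /andP[a0 a1] := a01 n => st.
by rewrite ler_wpM2l// lerD// ler_wpM2l ?ramp_homo// ?subr_ge0 ltW.
Qed.

Lemma pl_term_ge0 n t : 0 <= pl_term a n t.
Proof.
have /andP[a0 a1] := a01 n.
by rewrite mulr_ge0// addr_ge0// mulr_ge0 ?ramp_ge0// ?subr_ge0 ltW.
Qed.

Lemma pl_term_le_step n t : pl_term a n t <= dyad R n.+1 - dyad R n.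
Proof.
have /andP[a0 a1] := a01 n.
have := ramp_le (dyad R n) t (hstep_ge0 R n).
have := ramp_le (dyad R n + hstep R n) t (hstep_ge0 R n).
rewrite /pl_term dyadS; set r := ramp _ _ _; set q := ramp _ _ _; nra.
Qed.

Lemma pl_term_left n t : t <= dyad R n -> pl_term a n t = 0.
Proof.
move=> tn; rewrite /pl_term !ramp_left ?mulr0 ?addr0 ?mulr0//.
by rewrite (le_trans tn)// lerDl hstep_ge0.
Qed.

Lemma pl_term_right n t :
  dyad R n.+1 <= t -> pl_term a n t = dyad R n.+1 - dyad R n.
Proof.
rewrite dyadS => nt; have h0 := hstep_ge0 R n.
by rewrite /pl_term !ramp_right//; lra.
Qed.

Lemma pl_sum_ndecr t : nondecreasing_seq (pl_sum a ^~ t).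
Proof.
apply/nondecreasing_seqP => n; rewrite /pl_sum big_ord_recr/= lerDl.
exact: pl_term_ge0.
Qed.

(** The bounds on the individual terms telescope. *)
Lemma pl_sum_tail M N t : (N <= M)%N ->
  pl_sum a M t - pl_sum a N t <= dyad R M - dyad R N.
Proof.
elim: M => [|M IHM]; first by rewrite leqn0 => /eqP ->; rewrite !subrr.
rewrite leq_eqVlt => /predU1P[->|/IHM]; first by rewrite !subrr.
have := pl_term_le_step M t; rewrite /pl_sum big_ord_recr/= -/(pl_sum _ _ _);
  lra.
Qed.

Lemma pl_sum0 t : pl_sum a 0 t = 0. Proof. by rewrite /pl_sum big_ord0. Qed.

Lemma cvg_pl t : pl_sum a N t @[N --> \oo] --> (pl a t : R).
Proof.
apply: nondecreasing_is_cvgn; first exact: pl_sum_ndecr.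
exists 1 => _ [n _ <-].
have := pl_sum_tail t (leq0n n); rewrite pl_sum0 dyad0 !subr0 => /le_trans;
  apply.
exact/ltW/dyad_lt1.
Qed.

Lemma pl_sum_le_pl N t : pl_sum a N t <= pl a t.
Proof.
by apply: nondecreasing_cvgn_le; [exact: pl_sum_ndecr|exact: cvg_pl].
Qed.

(** The error is uniform in [t] and in the weights, which gives the continuity of [pl] in the
    weights later on. *)
Lemma pl_tail N t : pl a t <= pl_sum a N t + (1 - dyad R N).
Proof.
apply: (cvgr_to_le (@cvg_pl t)); near=> M.
have := @pl_sum_tail M N t; have := dyad_lt1 R M.
have NM : (N <= M)%N by near: M; exact: nbhs_infty_ge.
by move=> ? /(_ NM) ?; lra.
Unshelve. all: by end_near. Qed.

Lemma pl_sum_stable M N t : (N <= M)%N -> t <= dyad R N ->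
  pl_sum a M t = pl_sum a N t.
Proof.
move=> + tN; elim: M => [|M IHM]; first by rewrite leqn0 => /eqP ->.
rewrite leq_eqVlt => /predU1P[->//|NM].
rewrite /pl_sum big_ord_recr/= pl_term_left ?addr0; first exact: IHM.
by rewrite (le_trans tN)// dyad_le.
Qed.

Lemma pl_stable N t : t <= dyad R N -> pl a t = pl_sum a N t.
Proof.
move=> tN; apply/eqP; rewrite eq_le pl_sum_le_pl andbT.
apply: (cvgr_to_le (@cvg_pl t)); near=> M.
rewrite (@pl_sum_stable M N)//; near: M; exact: nbhs_infty_ge.
Unshelve. all: by end_near. Qed.

Lemma pl_sum_right N t : dyad R N <= t -> pl_sum a N t = dyad R N.
Proof.
elim: N => [|N IHN] Nt; first by rewrite pl_sum0 dyad0.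
rewrite /pl_sum big_ord_recr/= -/(pl_sum _ _ _) IHN ?pl_term_right//.
  by rewrite addrC subrK.
by rewrite (le_trans _ Nt)// dyad_le.
Qed.

Lemma pl_dyad N : pl a (dyad R N) = dyad R N.
Proof. by rewrite (@pl_stable N)// pl_sum_right. Qed.

(** The value at the midpoint determines the weight [a N]. *)
Lemma pl_mid N : pl a (dyad R N + hstep R N) = dyad R N + 2 * a N * hstep R N.
Proof.
have h0 := hstep_ge0 R N.
rewrite (@pl_stable N.+1); last by rewrite dyadS lerDl.
rewrite /pl_sum big_ord_recr/= -/(pl_sum _ _ _) pl_sum_right ?lerDl//.
by rewrite /pl_term ramp_right// ramp_left// mulr0 addr0 mulrA.
Qed.

Lemma pl0 : pl a 0 = 0.
Proof. by rewrite -(dyad0 R) pl_dyad. Qed.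

Lemma pl1 : pl a 1 = 1.
Proof.
apply/(cvg_lim (@Rhausdorff R)).
under eq_fun do rewrite pl_sum_right ?(ltW (dyad_lt1 _ _))//.
exact: cvg_dyad.
Qed.

Lemma pl_sum_incr_homo M N s t : (N <= M)%N -> s <= t ->
  pl_sum a N t - pl_sum a N s <= pl_sum a M t - pl_sum a M s.
Proof.
move=> + st; elim: M => [|M IHM]; first by rewrite leqn0 => /eqP ->.
rewrite leq_eqVlt => /predU1P[->//|/IHM /le_trans]; apply.
rewrite /pl_sum !big_ord_recr/= opprD addrACA lerDl subr_ge0.
exact: pl_term_homo.
Qed.

Lemma pl_sum_incr_le N s t : s <= t ->
  pl_sum a N t - pl_sum a N s <= pl a t - pl a s.
Proof.
move=> st; apply: (cvgr_to_ge (cvgB (@cvg_pl t) (@cvg_pl s))); near=> M.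
by apply: pl_sum_incr_homo => //; near: M; exact: nbhs_infty_ge.
Unshelve. all: by end_near. Qed.

End weights.

Lemma pl_le a a' C s t : in01 a -> in01 a' ->
  (forall n, a n <= C * a' n /\ 1 - a n <= C * (1 - a' n)) -> s <= t ->
  pl a t - pl a s <= C * (pl a' t - pl a' s).
Proof.
move=> a01 a'01 aC st.
have cl : pl_sum a N t - pl_sum a N s @[N --> \oo] --> (pl a t - pl a s : R).
  exact: (cvgB (@cvg_pl _ a01 t) (@cvg_pl _ a01 s)).
have cr : C * (pl_sum a' N t - pl_sum a' N s) @[N --> \oo] -->
    (C * (pl a' t - pl a' s) : R).
  exact: (cvgMl_tmp (cvgB (@cvg_pl _ a'01 t) (@cvg_pl _ a'01 s))).
by apply: (ler_cvg_to cl cr); apply: nearW => N; apply: pl_sum_le.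
Qed.

Definition half (_ : nat) : R := 2^-1.

Lemma half01 : in01 half.
Proof. by move=> n; rewrite invr_gt0 ltr0n/= invf_lt1// ltr1n. Qed.

(** With equal weights the ramps, laid end to end, merge into one by [rampD]. *)
Lemma pl_sum_half N t : pl_sum half N t = ramp 0 (dyad R N) t.
Proof.
elim: N => [|N IHN].
  by rewrite pl_sum0 dyad0 /ramp (max_idPl _)// ge_min lexx orbT.
rewrite /pl_sum big_ord_recr/= -/(pl_sum _ _ _) IHN /pl_term /half.
have -> : 1 - 2^-1 = 2^-1 :> R by lra.
rewrite -mulrDr mulVKf ?pnatr_eq0// rampD ?hstep_ge0//.
rewrite -{2}[dyad R N]add0r rampD ?dyad_ge0 ?addr_ge0 ?hstep_ge0//.
by rewrite dyadS addrA.
Qed.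

Lemma pl_half t : 0 <= t <= 1 -> pl half t = t.
Proof.
move=> /andP[t0]; rewrite le_eqVlt => /predU1P[->|t1].
  exact: pl1.
have [N tN] : exists N, t <= dyad R N.
  have : \forall N \near \oo, t <= dyad R N.
    by apply: (cvgr_ge (1 : R)) => //; exact: cvg_dyad.
  by case=> N _ /(_ N (leqnn N)); exists N.
rewrite (pl_stable half01 tN) pl_sum_half /ramp subr0.
by rewrite (min_idPl tN) (max_idPr t0).
Qed.

(** Only finitely many weights occur, so one constant [C] compares them with 1/2, and an increment
    that is not positive for [a] is not positive for [half]. *)
Lemma pl_sum_inj a N s t : in01 a -> s <= t ->
  pl_sum a N t <= pl_sum a N s -> pl_sum half N t <= pl_sum half N s.
Proof.
move=> a01 st aN.
have [C [C0 CN]] : exists C, 0 <= C /\ forall n, (n < N)%N ->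
    half n <= C * a n /\ 1 - half n <= C * (1 - a n).
  elim: N {aN} => [|N [C [C0 IHC]]]; first by exists 0.
  have /andP[a0 a1] := a01 N; rewrite -subr_gt0 in a1.
  (* The two inverses take care of [a N] and [1 - a N], since [half N <= 1]. *)
  exists (Num.max C ((a N)^-1 + (1 - a N)^-1)).
  split=> [|n]; first by rewrite le_max C0.
  rewrite ltnS leq_eqVlt => /predU1P[->|/IHC[h1 h2]].
    have -> : 1 - half N = half N by rewrite /half; lra.
    have h1 : half N <= 1 by rewrite /half; lra.
    split; apply: (le_trans h1).
      rewrite -[leLHS](mulVf (lt0r_neq0 a0)) ler_wpM2r ?(ltW a0)// le_max lerDl
        invr_ge0.
      by rewrite (ltW a1) orbT.
    rewrite -[leLHS](mulVf (lt0r_neq0 a1)) ler_wpM2r ?(ltW a1)// le_max lerDr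
      invr_ge0.
    by rewrite (ltW a0) orbT.
  have /andP[an0 an1] := a01 n.
  split; [apply: (le_trans h1)|apply: (le_trans h2)];
    by rewrite ler_wpM2r ?subr_ge0 ?(ltW an0) ?(ltW an1)// le_max lexx.
rewrite -subr_le0 (le_trans (pl_sum_le CN st))// mulr_ge0_le0//.
by rewrite subr_le0.
Qed.

(** The weights may approach 0 or 1, so no uniform lower bound on slopes is available. If [pl a] did
    not grow from [s] to [t], neither would any partial sum, nor by [pl_sum_inj] those of the
    identity. *)
Lemma pl_incr a s t : in01 a -> 0 <= s -> s < t -> t <= 1 -> pl a s < pl a t.
Proof.
move=> a01 s0 st t1; rewrite ltNge; apply/negP => ats; move: (st).
rewrite -(pl_half (t := s)); last by rewrite s0 (le_trans (ltW st)).
rewrite -[X in _ < X]pl_half; last by rewrite t1 (le_trans s0 (ltW st)).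
rewrite ltNge => /negP; apply.
apply: (ler_cvg_to (@cvg_pl _ half01 t) (@cvg_pl _ half01 s));
  apply: nearW => N.
apply: (pl_sum_inj a01 (ltW st)).
by have := pl_sum_incr_le a01 N (ltW st); lra.
Qed.

(** Comparison with the identity [pl half], as weights are at most twice 1/2. *)
Lemma pl_lipschitz a s t : in01 a -> 0 <= s -> s <= t -> t <= 1 ->
  pl a t - pl a s <= 2 * (t - s).
Proof.
move=> a01 s0 st t1; rewrite -{2}(pl_half (t := s)); last first.
  by rewrite s0 (le_trans st).
rewrite -{2}(pl_half (t := t)); last by rewrite t1 (le_trans s0).
by apply: pl_le => // [|n]; [exact: half01|]; have := a01 n; rewrite /half; lra.
Qed.

End piecewise_linear.

(** * Homeomorphisms from increasing real functions *)

Section homeo_of_real_function.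
Variable R : realType.

Local Notation I := (unit_interval R).

(** The intermediate value theorem gives surjectivity. The inverse need not be Lipschitz; its
    continuity comes from that of inverses of continuous injections on a segment. *)
Lemma incr_homeo_of_real (f : R -> R) (C : R) : f 0 = 0 -> f 1 = 1 ->
  (forall s t, 0 <= s -> s < t -> t <= 1 -> f s < f t) ->
  (forall s t, 0 <= s -> s <= t -> t <= 1 -> f t - f s <= C * (t - s)) ->
  exists h : incr_homeo R, forall x, set_val (h x) = f (set_val x).
Proof.
move=> f0 f1 f_incr fC.
have f_homo s t : 0 <= s -> s <= t -> t <= 1 -> f s <= f t.
  move=> s0; rewrite le_eqVlt => /predU1P[->//|st t1].
  by rewrite ltW// f_incr.
have f01 x : 0 <= x <= 1 -> 0 <= f x <= 1.
  by move=> /andP[x0 x1];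
    rewrite -[X in X <= f x]f0 -[X in _ <= _ <= X]f1 !f_homo.
pose F (x : I) : I := clamp01 (f (set_val x)).
have FE x : set_val (F x) = f (set_val x) by rewrite clamp01K// f01//
  set_val_itv01.
have F_lip : lipschitz_le C F.
  move=> x y; rewrite !FE.
  wlog xy : x y / set_val x <= set_val y => [hw|].
    by have /orP[/hw//|/hw] := le_total (set_val x) (set_val y);
      rewrite distrC [X in C * X]distrC.
  have /andP[x0 x1] := set_val_itv01 x; have /andP[y0 y1] := set_val_itv01 y.
  rewrite distrC [X in C * X]distrC !ger0_norm ?subr_ge0//; last exact: f_homo.
  exact: fC.
have f_ct : {within `[0, 1], continuous f}.
  apply/subspace_sigL_continuousP.
  rewrite (_ : sigL _ f = set_val \o F); last by apply/funext => x/=;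
    rewrite FE.
  move=> x; apply: continuous_comp;
    first exact: (lipschitz_le_continuous F_lip).
  exact: set_val_continuous.
have /choice[g gP] y : exists x, 0 <= y <= 1 -> 0 <= x <= 1 /\ f x = y.
  have [y01|] := boolP (0 <= y <= 1); last by exists 0.
  have [] := @IVT _ f 0 1 y ler01 f_ct.
    by rewrite f0 f1 (min_idPl ler01) (max_idPr ler01).
  by move=> x; rewrite in_itv/= => x01 fx; exists x.
have fK x : 0 <= x <= 1 -> g (f x) = x.
  move=> x01; have [g01 fg] := gP _ (f01 _ x01).
  have /andP[x0 x1] := x01; have /andP[g0 g1] := g01.
  case: (ltgtP (g (f x)) x) => // [gx|xg].
    by have := f_incr _ _ g0 gx x1; rewrite fg ltxx.
  by have := f_incr _ _ x0 xg g1; rewrite fg ltxx.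
pose G (y : I) : I := clamp01 (g (set_val y)).
have GE y : set_val (G y) = g (set_val y).
  by rewrite clamp01K//; have [] := gP _ (set_val_itv01 y).
have FK : cancel F G.
  by move=> x; apply: set_val_inj; rewrite GE FE fK// set_val_itv01.
have GK : cancel G F.
  move=> y; apply: set_val_inj; rewrite FE GE.
  by have [] := gP _ (set_val_itv01 y).
have F_incr : {homo F : x y / set_val x < set_val y}.
  move=> x y xy; rewrite !FE; apply: f_incr => //.
    by have /andP[] := set_val_itv01 x.
  by have /andP[] := set_val_itv01 y.
have g_ct : {within `[0, 1], continuous g}.
  have := @segment_can_le_continuous _ 0 1 f g ler01; rewrite f0 f1; exact.
have G_ct : continuous G.
  move/subspace_sigL_continuousP : g_ct => g_ct.
  apply: continuous_set_val => y e e0.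
  have : \forall z \near y, `|g (set_val y) - g (set_val z)| < e.
    exact: (iffLR (@cvgrPdist_lt _ _ _ (nbhs y) _ _ _) (g_ct y)).
  by apply: filterS => z; rewrite !GE.
by exists (IncrHomeo FK GK (lipschitz_le_continuous F_lip) G_ct F_incr).
Qed.

End homeo_of_real_function.

(** * The logistic function *)

Section logistic.
Variable R : realType.
Implicit Types x y : R.

(** The weight [a] with [a / (1 - a) = expR x], so that the two slopes of [pl] have ratio
    [expR x]. *)
Definition logistic x : R := (1 + expR (- x))^-1.

Lemma logistic_den_gt0 x : 0 < 1 + expR x.
Proof. by rewrite addr_gt0// expR_gt0. Qed.

Lemma logistic01 x : 0 < logistic x < 1.
Proof.
by rewrite invr_gt0 logistic_den_gt0 invf_lt1 ?logistic_den_gt0// ltrDl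
  expR_gt0.
Qed.

Lemma logistic_expR x : logistic x = expR x * logistic (- x).
Proof.
rewrite /logistic opprK expRN.
have := expR_gt0 x; have := logistic_den_gt0 x; set e := expR x => e1 e0.
by field; rewrite !gt_eqF//= addrC.
Qed.

Lemma logisticN x : logistic (- x) = 1 - logistic x.
Proof.
rewrite /logistic opprK expRN.
have := expR_gt0 x; have := logistic_den_gt0 x; set e := expR x => e1 e0.
by field; rewrite !gt_eqF//= addrC.
Qed.

Lemma logistic_le M x y : `|x - y| <= M -> logistic x <= expR M * logistic y.
Proof.
rewrite ler_norml => /andP[xyM xyM'].
have dx := logistic_den_gt0 (- x); have dy := logistic_den_gt0 (- y).
rewrite /logistic ler_pdivlMr// mulrC ler_pdivrMr// mulrDr mulr1.
rewrite -expRD lerD ?ler_expR//; last lra.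
by rewrite -[leLHS]expR0 ler_expR; lra.
Qed.

(** Since [expR x] is the quotient of [logistic x] by [logistic (- x)], multiplying the two
    hypotheses bounds [expR (x - y)] by [C * C]. *)
Lemma logistic_ge C x y : 0 < C -> logistic x <= C * logistic y ->
  1 - logistic y <= C * (1 - logistic x) -> x - y <= ln (C * C).
Proof.
move=> C0; rewrite -!logisticN => h1 h2.
have /andP[nx0 _] := logistic01 (- x); have /andP[ny0 _] := logistic01 (- y).
rewrite -ler_expR lnK ?posrE ?mulr_gt0// expRD expRN ler_pdivrMr ?expR_gt0//.
rewrite logistic_expR [logistic y]logistic_expR in h1.
rewrite -(ler_pM2r nx0) -(ler_pM2r ny0).
have := expR_gt0 x; have := expR_gt0 y; set ex := expR x; set ey := expR y.
move=> ey0 ex0.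
rewrite (le_trans (ler_wpM2r (ltW ny0) h1))// [leRHS](_ : _ =
  (C * (ey * logistic (- y))) * (C * logistic (- x))); last by ring.
by rewrite ler_wpM2l// !mulr_ge0 ?ltW.
Qed.

Lemma logistic_continuous : continuous logistic.
Proof.
move=> x; apply: cvgV; first by rewrite gt_eqF// logistic_den_gt0.
apply: cvgD; first exact: cvg_cst.
apply: (@cvg_comp _ _ _ (fun t : R => - t) expR); last exact: continuous_expR.
exact: opp_continuous.
Qed.

End logistic.

(** * Reducing bounded distance of sequences to E^S *)

Section ell_infty_to_ES.
Variable R : realType.

Local Notation I := (unit_interval R).

Definition weights (x : nat -> R) (n : nat) : R := logistic (x n).

Lemma weights01 x : in01 (weights x).
Proof. by move=> n; exact: logistic01. Qed.

Lemma pl_homeo_subproof (x : nat -> R) :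
  exists h : incr_homeo R, forall t, set_val (h t) = pl (weights x) (set_val t).
Proof.
have w01 := weights01 x.
apply: (incr_homeo_of_real (pl0 w01) (@pl1 _ _)) => s t s0 st t1.
  exact: pl_incr.
exact: (pl_lipschitz w01 s0 st t1).
Qed.

(* Kept opaque: unfolding [pl_homeo] during unification is very slow. *)
Lemma pl_homeo_sig : {H : (nat -> R) -> incr_homeo R |
  forall x t, set_val (H x t) = pl (weights x) (set_val t)}.
Proof.
exists (fun x => projT1 (cid (pl_homeo_subproof x))) => x.
exact: (projT2 (cid (pl_homeo_subproof x))).
Qed.

Definition pl_homeo : (nat -> R) -> incr_homeo R := sval pl_homeo_sig.

Lemma pl_homeoE x t : set_val (pl_homeo x t) = pl (weights x) (set_val t).
Proof. exact: (svalP pl_homeo_sig). Qed.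

Lemma pl_homeo_le (M : R) (x y : nat -> R) s t :
  (forall n, `|x n - y n| <= M) ->
  `|set_val (pl_homeo x s) - set_val (pl_homeo x t)| <=
  expR M * `|set_val (pl_homeo y s) - set_val (pl_homeo y t)|.
Proof.
move=> xyM.
wlog st : s t / set_val s <= set_val t => [hw|].
  have /orP[/hw//|/hw] := le_total (set_val s) (set_val t).
  rewrite (distrC (set_val (pl_homeo x t))).
  by rewrite (distrC (set_val (pl_homeo y t))).
rewrite (distrC (set_val (pl_homeo x s))) (distrC (set_val (pl_homeo y s))).
rewrite !ger0_norm ?subr_ge0 ?homeo_le//.
rewrite !pl_homeoE; apply: pl_le => // [||n];
  [exact: weights01|exact: weights01|].
rewrite -!logisticN; split; apply: logistic_le; first exact: xyM.
by rewrite -opprD normrN.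
Qed.

(** Even indices give the points [dyad n], odd ones the midpoints between them, so the enumeration
    is increasing. *)
Definition breakpoint (k : nat) : I :=
  clamp01 (dyad R k./2 + if odd k then hstep R k./2 else 0).

Lemma breakpointE k :
  set_val (breakpoint k) = dyad R k./2 + if odd k then hstep R k./2 else 0.
Proof.
rewrite clamp01K//; have := dyad_ge0 R k./2; have := dyad_lt1 R k./2.
have := dyadS R k./2; have := dyad_lt1 R k./2.+1; have := hstep_gt0 R k./2.
by case: odd => ? ? ? ? ?; apply/andP; split; lra.
Qed.

Lemma breakpoint_even n : set_val (breakpoint n.*2) = dyad R n.
Proof. by rewrite breakpointE doubleK odd_double addr0. Qed.

Lemma breakpoint_odd n : set_val (breakpoint n.*2.+1) = dyad R n + hstep R n.
Proof. by rewrite breakpointE/= odd_double/= uphalf_double. Qed.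

Lemma breakpointS k : set_val (breakpoint k) < set_val (breakpoint k.+1).
Proof.
rewrite -[k]odd_double_half; case: odd => /=; rewrite ?add1n ?add0n.
  rewrite -doubleS breakpoint_even breakpoint_odd dyadS;
    have := hstep_gt0 R k./2; lra.
by rewrite breakpoint_even breakpoint_odd ltrDl hstep_gt0.
Qed.

Lemma pl_homeo_even x n : set_val (pl_homeo x (breakpoint n.*2)) = dyad R n.
Proof. by rewrite pl_homeoE breakpoint_even pl_dyad//; exact: weights01. Qed.

Lemma pl_homeo_odd x n : set_val (pl_homeo x (breakpoint n.*2.+1)) =
  dyad R n + 2 * weights x n * hstep R n.
Proof. by rewrite pl_homeoE breakpoint_odd pl_mid//; exact: weights01. Qed.

Definition breakpoint_le (C : R) (h1 h2 : incr_homeo R) := forall k,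
  `|set_val (h1 (breakpoint k.+1)) - set_val (h1 (breakpoint k))| <=
  C * `|set_val (h2 (breakpoint k.+1)) - set_val (h2 (breakpoint k))|.

(** The increments at even and odd indices are [2 * hstep R n] times the weight and times its
    complement; the common factor cancels. *)
Lemma weights_le (x y : nat -> R) (C : R) :
  breakpoint_le C (pl_homeo x) (pl_homeo y) ->
  forall n, weights x n <= C * weights y n /\
    1 - weights x n <= C * (1 - weights y n).
Proof.
move=> xyC n; have h0 := hstep_gt0 R n.
have /andP[x0 x1] := weights01 x n; have /andP[y0 y1] := weights01 y n.
have wh (w : R) : 0 <= w -> 0 <= 2 * w * hstep R n.
  by move=> w0; apply: mulr_ge0 (ltW h0); exact: mulr_ge0.
split.
  have := xyC n.*2; rewrite !pl_homeo_even !pl_homeo_odd !(addrC (dyad R n))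
    !addrK.
  by rewrite !ger0_norm ?wh ?(ltW x0) ?(ltW y0)// [leRHS]mulrA ler_pM2r//
    mulrCA ler_pM2l.
have := xyC n.*2.+1; rewrite -doubleS !pl_homeo_even !pl_homeo_odd dyadS.
have dE (w : R) : dyad R n + hstep R n + hstep R n -
    (dyad R n + 2 * w * hstep R n) = 2 * (1 - w) * hstep R n by ring.
rewrite !dE !ger0_norm ?wh ?subr_ge0 ?(ltW x1) ?(ltW y1)//.
by rewrite [leRHS]mulrA ler_pM2r// mulrCA ler_pM2l.
Qed.

Lemma breakpoint_bounded (x y : nat -> R) (C : R) : 0 < C ->
  breakpoint_le C (pl_homeo x) (pl_homeo y) ->
  breakpoint_le C (pl_homeo y) (pl_homeo x) ->
  forall n, `|x n - y n| <= ln (C * C).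
Proof.
move=> C0 /weights_le xyC /weights_le yxC n.
have [xy1 xy2] := xyC n; have [yx1 yx2] := yxC n.
rewrite ler_norml lerNl opprB; apply/andP; split; exact: logistic_ge.
Qed.

Lemma weights_continuous N :
  continuous (fun x : {ptws nat -> R} => weights x N).
Proof.
move=> x; apply: (@continuous_comp _ _ _ (fun y : {ptws nat -> R} => y N)
  (@logistic R)); last exact: logistic_continuous.
exact: (@proj_continuous nat (fun=> R) N x).
Qed.

Lemma near_weights (x : {ptws nat -> R}) N (e : R) : 0 < e ->
  nbhs x [set y : {ptws nat -> R} |
    \sum_(n < N) `|weights x n - weights y n| < e].
Proof.
elim: N e => [|N IHN] e e0; first by apply: filterE => y; rewrite /= big_ord0.
have e20 : 0 < e / 2 by rewrite divr_gt0.
have wN : nbhs x [set y : {ptws nat -> R} | `|weights x N - weights y N| < e /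
  2].
  exact: (weights_continuous (nbhsx_ballx (weights x N) _ e20)).
apply: filterS (filterI wN (IHN _ e20)) => y [yN ysum].
by rewrite /= big_ord_recr/= (splitr e) ltrD.
Qed.

(** A term changes by [a n - b n] times twice a difference of two ramps, and that factor is at most
    [2 * hstep R n <= 1]. *)
Lemma pl_sum_dist (a b : nat -> R) N t :
  `|pl_sum a N t - pl_sum b N t| <= \sum_(n < N) `|a n - b n|.
Proof.
rewrite /pl_sum -sumrB (le_trans (ler_norm_sum _ _ _))//; apply: ler_sum => n _.
have := ramp_le (dyad R n) t (hstep_ge0 R n).
have := ramp_ge0 (dyad R n) (hstep R n) t.
have := ramp_le (dyad R n + hstep R n) t (hstep_ge0 R n).
have := ramp_ge0 (dyad R n + hstep R n) (hstep R n) t.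
rewrite /pl_term; set r := ramp _ _ _; set q := ramp _ _ _ => r0 rh q0 qh.
rewrite (_ : _ - _ = (a n - b n) * (2 * (q - r))); last by ring.
rewrite normrM ler_piMr// (le_trans _ (hstep_le2 R n))// normrM ger0_norm//.
by rewrite ler_pM2l// ler_norml; apply/andP; split; lra.
Qed.

(** The tails are uniformly small by [pl_tail], and a partial sum depends on finitely many
    coordinates, uniformly in the argument. *)
Lemma pl_homeo_continuous :
  continuous (pl_homeo : {ptws nat -> R} -> incr_homeo R).
Proof.
apply: homeo_continuous => x e e0.
have e30 : 0 < e / 3 by rewrite divr_gt0.
have [N Ne] : exists N, 1 - dyad R N < e / 3.
  have : \forall N \near \oo, 1 - e / 3 < dyad R N.
    by apply: (cvgr_gt (1 : R)); [exact: cvg_dyad|rewrite ltrBlDr ltrDl].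
  by case=> N _ /(_ N (leqnn N)); exists N; rewrite ltrBlDr -ltrBlDl.
apply: filterS (near_weights x N e30) => y xy; apply: sup_dist_le => t.
have := pl_sum_le_pl (weights01 x) N (set_val t).
have := pl_sum_le_pl (weights01 y) N (set_val t).
have := pl_tail (weights01 x) N (set_val t).
have := pl_tail (weights01 y) N (set_val t).
have := le_lt_trans (pl_sum_dist (weights x) (weights y) N (set_val t)) xy.
rewrite !pl_homeoE ltr_norml ler_norml.
move: (pl _ _) (pl _ _) (pl_sum _ _ _) (pl_sum _ _ _) (dyad R N) Ne.
by move=> u v p q d Ne /andP[? ?] ? ? ? ?; apply/andP; split; lra.
Qed.

Lemma ell_infty_le_ES_Lip : borel_reducible (@ell_infty R) (@ES_Lip R).
Proof.
exists (pl_homeo : {ptws nat -> R} -> incr_homeo R); split.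
  exact: (continuous_borel pl_homeo_continuous).
move=> x y; rewrite ell_inftyP; split=> [[M xyM]|/ES_LipP[C hC]].
  apply/ES_LipP; exists (expR M) => s t; split.
    by apply: pl_homeo_le => n; rewrite distrC.
  exact: pl_homeo_le.
have C0 : 0 < Num.max C 1 by rewrite lt_max ltr01 orbT.
have CW (a b : R) : a <= C * `|b| -> a <= Num.max C 1 * `|b|.
  by move=> /le_trans; apply; rewrite ler_wpM2r// le_max lexx.
exists (ln (Num.max C 1 * Num.max C 1)).
by apply: breakpoint_bounded => // k; apply: CW; apply hC.
Qed.

End ell_infty_to_ES.

(** * Rigidity of the image of the breakpoints *)

Section ell_infty_to_EH.
Variable R : realType.

Local Notation I := (unit_interval R).

Lemma unit_interval_compact : compact [set: I].
Proof.
rewrite compact_ultra => F FF _.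
have := @segment_compact R 0 1; rewrite compact_ultra.
move=> /(_ (set_val x @[x --> F]) (ultra_fmap _ FF)).
have F01 : \forall x \near F, 0 <= set_val (x : I) <= 1.
  by apply: filterE => x; exact: set_val_itv01.
case=> [|x /= [x01 Fx]].
  by apply: filterS F01 => x; rewrite /= in_itv.
exists (clamp01 x); split=> //=; apply: (@cvg_set_val _ _ F _ id) => e e0.
rewrite clamp01K//.
exact: (iffLR (@cvgrPdist_lt _ _ _ F _ _ _) Fx).
Qed.

Lemma open_set_val (U : set I) x : open U -> U x ->
  exists2 e : R, 0 < e & forall y, `|set_val x - set_val y| < e -> U y.
Proof.
move=> [W oW <-] /= Wx; have [e /= e0 eW] : nbhs_ball (set_val x : R) W.
  by apply/nbhs_ballP; exact: open_nbhs_nbhs.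
by exists e => // y xy; exact: eW.
Qed.

Lemma homeo_image_closed (h : incr_homeo R) (F : closed_subset I) :
  closed (h @` F).
Proof.
rewrite (_ : h @` F = homeo_inv h @^-1` F).
  apply: preimage_closed; last exact: closed_subset_closed.
  by move=> y _; exact: homeo_inv_continuous.
apply/seteqP; split=> [_ [x Fx <-]|y Fy] /=; first by rewrite homeo_funK.
by exists (homeo_inv h y) => //; rewrite homeo_invK.
Qed.

Definition homeo_image (F : closed_subset I) (h : incr_homeo R) :=
  ClosedSubset (@homeo_image_closed h F).

(** For the condition of lying inside [U], compactness of [F] makes one neighbourhood of [h] serve
    all points of [F]. For the condition of meeting [U], evaluation at one point is enough. *)
Lemma homeo_image_continuous F : continuous (homeo_image F).
Proof.
move=> h; apply: (cvg_vietoris (fmap_filter (homeo_image F) (nbhs_filter h)))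
  => U oU /=.
  move=> FU; have cF : compact (closed_subset_set F).
    by apply: subclosed_compact unit_interval_compact _ => //;
      exact: closed_subset_closed.
  have /compact_near_coveringP := cF.
  move=> /(_ _ (nbhs h) (fun g x => U (g x)) (nbhs_filter h)) FhU.
  apply: filterS (FhU _) => [g gU _ [x Fx <-]|x Fx]; first exact: gU.
  have [e e0 eU] : exists2 e : R, 0 < e &
      forall y, `|set_val (h x) - set_val y| < e -> U y.
    by apply: open_set_val => //; apply: FU; exists x.
  have e20 : 0 < e / 2 by rewrite divr_gt0.
  have hx : nbhs x (h @^-1` [set y | `|set_val (h x) - set_val y| < e / 2]).
    by apply: homeo_fun_continuous; exact: near_set_val.
  exists ([set x' | `|set_val (h x) - set_val (h x')| < e / 2],
          [set g | sup_dist h g < e / 2]).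
    by split=> //=; exact: near_sup_dist.
  move=> [x' g] /= [xx' hg]; apply: eU.
  rewrite (le_lt_trans (ler_distD (set_val (h x')) _ _))// (splitr e) ltrD//.
  exact: le_lt_trans (sup_dist_ub _ _ _) hg.
move=> [_ [[x Fx <-] Uhx]].
have hU : nbhs h ((fun g : incr_homeo R => g x) @^-1` U).
  by apply: eval_continuous; exact: open_nbhs_nbhs.
by apply: filterS hU => g gU; exists (g x); split => //; exists x.
Qed.

(* These are the points [breakpoint k] and 1; being the complement of countably
   many open gaps, this set is visibly closed. *)
Definition breakpoints : set I := [set x | forall k,
  ~ (set_val (breakpoint R k) < set_val x < set_val (breakpoint R k.+1))].

Lemma breakpoints_closed : closed breakpoints.
Proof.
rewrite (_ : breakpoints = \bigcap_k ~` (set_val @^-1`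
    `]set_val (breakpoint R k), set_val (breakpoint R k.+1)[)).
  apply: closed_bigI => k _; apply: open_closedC.
  have /continuousP := @set_val_continuous R; apply; exact: itv_open.
apply/seteqP; split=> x xB k; first by move=> _; rewrite /= in_itv; exact: xB.
by have := xB k Logic.I; rewrite /= in_itv.
Qed.

Lemma breakpoint_homo j k : (j <= k)%N ->
  set_val (breakpoint R j) <= set_val (breakpoint R k).
Proof.
move=> /subnK <-; elim: (k - j)%N => // n IHn.
by rewrite (le_trans IHn)// addSn ltW// breakpointS.
Qed.

Lemma breakpoint_breakpoints k : breakpoints (breakpoint R k).
Proof.
move=> j /andP[]; case: (leqP k j) => [/breakpoint_homo kj|/breakpoint_homo jk].
  by rewrite ltNge kj.
by move=> _; rewrite ltNge jk.
Qed.

(** By induction, the image of breakpoint [k+1] lies strictly above breakpoint [k], and no element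
    of [breakpoints] lies strictly between the two. *)
Lemma breakpoint_rigid (g : incr_homeo R) :
  (forall x, breakpoints x -> breakpoints (g x)) ->
  forall k, set_val (breakpoint R k) <= set_val (g (breakpoint R k)).
Proof.
move=> gB; elim=> [|k IHk].
  rewrite -[0%N]double0 breakpoint_even dyad0.
  by have /andP[] := set_val_itv01 (g (breakpoint R 0.*2)).
rewrite leNgt; apply/negP => gk.
have /(_ k) := gB _ (@breakpoint_breakpoints k.+1); apply; rewrite gk andbT.
by rewrite (le_lt_trans IHk)// homeo_lt breakpointS.
Qed.

(** Apply [breakpoint_rigid] to [g] and to its inverse. *)
Lemma breakpoint_fixed (g : incr_homeo R) : g @` breakpoints = breakpoints ->
  forall k, g (breakpoint R k) = breakpoint R k.
Proof.
move=> gB k; apply: set_val_inj; apply/eqP; rewrite eq_le; apply/andP; split.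
  have g'k : set_val (breakpoint R k) <= set_val (homeo_sym g (breakpoint R k)).
    apply: breakpoint_rigid => x; rewrite -{1}gB => -[y yB <-] /=.
    by rewrite homeo_funK.
  by move: g'k; rewrite -(homeo_le g) /= homeo_invK.
by apply: breakpoint_rigid => x xB; rewrite -gB; exists x.
Qed.

Lemma ell_infty_le_EH_Lip : borel_reducible (@ell_infty R) (@EH_Lip R).
Proof.
pose B := ClosedSubset breakpoints_closed.
pose f : {ptws nat -> R} -> closed_subset I := homeo_image B \o @pl_homeo R.
have cf : continuous f.
  move=> x; apply: (@continuous_comp {ptws nat -> R} (incr_homeo R)
    (closed_subset I)).
    exact: pl_homeo_continuous.
  exact: homeo_image_continuous.
exists f; split; first exact: (continuous_borel cf).
move=> x y; rewrite ell_inftyP; split=> [[M xyM]|[g [[C gC] [D gD]] gF]].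
  have [g gLip gxy] : ES_Lip (pl_homeo x) (pl_homeo y).
    apply/ES_LipP; exists (expR M) => s t; split.
      by apply: pl_homeo_le => n; rewrite distrC.
    exact: pl_homeo_le.
  by exists g => //=; rewrite image_comp gxy.
have gk k : g (pl_homeo x (breakpoint R k)) = pl_homeo y (breakpoint R k).
  (* Conjugation turns [g] into a homeomorphism that preserves [breakpoints], which therefore fixes
     each breakpoint. *)
  pose G := homeo_comp (homeo_sym (pl_homeo y)) (homeo_comp g (pl_homeo x)).
  have GB : G @` breakpoints = breakpoints.
    rewrite /= -image_comp -[X in _ @` X]image_comp -/(closed_subset_set B).
    move: gF => /= ->; rewrite image_comp (_ : _ \o _ = id) ?image_id//.
    by apply/funext => z /=; rewrite homeo_funK.
  by rewrite -[in RHS](breakpoint_fixed GB) /= homeo_invK.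
pose E := Num.max (Num.max C D) 1.
have E0 : 0 < E by rewrite lt_max ltr01 orbT.
have CE : C <= E by rewrite !le_max lexx.
have DE : D <= E by rewrite !le_max lexx orbT.
exists (ln (E * E)); apply: breakpoint_bounded => // k; rewrite -!gk.
  rewrite -{1}(homeo_funK g (pl_homeo x (breakpoint R k.+1))).
  rewrite -{1}(homeo_funK g (pl_homeo x (breakpoint R k))).
  exact: (lipschitz_leW DE gD).
exact: (lipschitz_leW CE gC).
Qed.

End ell_infty_to_EH.

Theorem corollary3p9 (R : realType) :
  borel_bireducible (@EH_Lip R) (@ell_infty R) /\
  borel_bireducible (@ES_Lip R) (@ell_infty R).
Proof.
split; split.
- exact: EH_Lip_le_ell_infty.
- exact: ell_infty_le_EH_Lip.
- exact: ES_Lip_le_ell_infty.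
- exact: ell_infty_le_ES_Lip.
Qed.
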